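(* There exists a field $K$ such that: (1) there are infinitely many pairwise nonisomorphic quaternion division algebras with center $K$; and (2) any two quaternion division algebras with center $K$ are weakly isomorphic.
   Context: Let $D$ be a division algebra with center $K$, finite-dimensional over $K$. The maximal subfields of $D$ are the maximal elements of the poset of fields $E$ with $K\subset E\subset D$. $\mathrm{Max}(D)$ denotes the set of isomorphism classes (as field extensions of $K$) of maximal subfields of $D$. Two division algebras $D, D'$ with center $K$ are called weakly isomorphic if $\mathrm{Max}(D)=\mathrm{Max}(D')$. *)

(* Defs.v *)
From mathcomp Require Import all_boot all_algebra all_field.

Set Implicit Arguments.
Unset Strict Implicit.
Unset Printing Implicit Defensive.

Local Open Scope ring_scope.

Definition alg_isomorphic (K : fieldType) (A B : falgType K) : Prop :=
  exists f : 'AHom(A, B), bijective f.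

Definition is_division_algebra (K : fieldType) (D : falgType K) : Prop :=
  forall x : D, x != 0 -> x \is a GRing.unit.

(* [1%VS] is the line K.1, i.e. the image of K in D. *)
Definition is_central (K : fieldType) (D : falgType K) : Prop :=
  ('Z({:D}) = 1)%VS.

Definition is_central_division (K : fieldType) (D : falgType K) : Prop :=
  is_division_algebra D /\ is_central D.

(* Quaternion algebras are the central simple algebras of degree 2, i.e. of
   dimension 4, so that the characteristic of K is not restricted. *)
Definition is_quaternion_division (K : fieldType) (D : falgType K) : Prop :=
  is_central_division D /\ \dim {:D} = 4%N.

(* The unit of an [{aspace D}] may differ from that of D, hence the condition
   [1 \in E]; as E is a K-subspace, it amounts to E containing K. *)
Definition is_subfield (K : fieldType) (D : falgType K) (E : {aspace D}) : Prop :=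
  [/\ 1 \in E,
      {in E &, forall x y : D, x * y = y * x} &
      {in E, forall x : D, x != 0 -> (x \is a GRing.unit) /\ (x^-1 \in E)}].

Definition is_maximal_subfield (K : fieldType) (D : falgType K)
    (E : {aspace D}) : Prop :=
  is_subfield E /\
  forall F : {aspace D}, is_subfield F -> (E <= F)%VS -> (F : {vspace D}) = E.

(* A set of isomorphism classes of finite field extensions of K is represented
   by the predicate "the class of L belongs to the set" on such extensions L. *)
Definition Max (K : fieldType) (D : falgType K) (L : fieldExtType K) : Prop :=
  exists E : {aspace D}, is_maximal_subfield E /\ alg_isomorphic L (subvs_of E).

Definition weakly_isomorphic (K : fieldType) (D D' : falgType K) : Prop :=
  forall L : fieldExtType K, Max D L <-> Max D' L.

(* Main.v *)
Require Import Defs.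
From HB Require Import structures.
From mathcomp Require Import all_boot all_algebra all_field.
From mathcomp Require Import ring zify.
From mathcomp Require Import boolp.

(** Write [(a, s)] for the quaternion algebra generated by [i] and [j] with
    [i^2 = a], [j^2 = s] and [ij = -ji].  Its norm form is [<1, -a, -s, as>],
    and it is a division algebra exactly when this form is anisotropic; the
    squares of its pure quaternions are the values of [<a, s, -as>].

    In characteristic not 2, the maximal subfields of a quaternion division
    algebra are the centralizers of its non-scalar elements, and each of them
    is [K(x)] for some [x] whose square is a non-square [a'] of [K].  So
    [K(sqrt a')] embeds in [(b, c)] as soon as [a'] is a value of
    [<b, c, -bc>].  Hence all quaternion division algebras over [K] are weakly
    isomorphic if every such form represents every non-square of [K]
    ([Max_transfer]), and it remains to build a field with this property
    that still has infinitely many quaternion division algebras.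

    Start from the countable field Q(t) and force the representations one at a
    time.  For given [a'], [b], [c] over [K], pass to [K(y)(x)(sqrt d)], where
    [d = a'b x^2 + a'c y^2 - a'bc]; there [a'] is visibly a value of
    [<b, c, -bc>].  The crucial point is that every division algebra [(a, s)]
    over [K] survives this step ([solving_extension]).  If not, [d] would be
    the square of a pure quaternion of [(a, s)] over [K(y)(x)]
    ([norm_form_sqrt_ext]).  The theorem of Cassels and Pfister, applied in [x]
    and then, after a reflection, in [y], would yield three pairwise orthogonal
    pure quaternions over [K] with squares [a'b], [a'c] and [-a'bc]; since
    [<a, s, -as>] has determinant minus a square, [a'] would be a square
    ([generic_value_not_represented]).  Treating all triples of a countable
    field in turn, iterating, and taking unions of the resulting towers gives
    the field ([representing_closure]).

    Over Q(t) the algebras [(-1, t - n)] and [(-1, (t - m)(t - n))], for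
    distinct [m] and [n], are division algebras, because [t - n] has a simple
    zero and [-1] is not a square in Q.  They survive in the union.  By the
    argument of Skolem and Noether, an isomorphism between [(a, s)] and
    [(a, t)] makes [st] a norm from [K(sqrt a)], so that [(a, st)] is split
    ([quaternion_iso_norm]); therefore the algebras [(-1, t - n)] stay pairwise
    non-isomorphic. *)

Set Implicit Arguments.
Unset Strict Implicit.
Unset Printing Implicit Defensive.

Import GRing.Theory.
Local Open Scope ring_scope.

Local Notation tofrac := (@FracField.tofrac _).
Local Notation "x %:F" := (@FracField.tofrac _ x).

(** * Diagonal quadratic forms *)

Definition qform (R : comNzRingType) n (c v : 'I_n -> R) : R :=
  \sum_i c i * v i ^+ 2.

Definition bform (R : comNzRingType) n (c u v : 'I_n -> R) : R :=
  \sum_i c i * u i * v i.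

Definition anisotropic (R : comNzRingType) n (c : 'I_n -> R) : Prop :=
  forall v, qform c v = 0 -> forall i, v i = 0.

Section FormTheory.

Variables (R : comNzRingType) (n : nat) (c : 'I_n -> R).
Implicit Types u v w : 'I_n -> R.

Lemma bformC u v : bform c u v = bform c v u.
Proof. by apply: eq_bigr => i _; ring. Qed.

Lemma bform_comb w u v a b :
  bform c w (fun i => a * u i + b * v i) = a * bform c w u + b * bform c w v.
Proof.
rewrite /bform !mulr_sumr -big_split; apply: eq_bigr => i _ /=; ring.
Qed.

Lemma qform_comb u v a b :
  qform c (fun i => a * u i + b * v i) =
  a ^+ 2 * qform c u + 2 * a * b * bform c u v + b ^+ 2 * qform c v.
Proof.
rewrite /qform /bform !mulr_sumr -!big_split; apply: eq_bigr => i _ /=; ring.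
Qed.

Lemma bformZr u v a : bform c u (fun i => a * v i) = a * bform c u v.
Proof. by rewrite /bform mulr_sumr; apply: eq_bigr => i _; ring. Qed.

Lemma qformZ v a : qform c (fun i => a * v i) = a ^+ 2 * qform c v.
Proof. by rewrite /qform mulr_sumr; apply: eq_bigr => i _; ring. Qed.

Lemma eq_qform u v : u =1 v -> qform c u = qform c v.
Proof. by move=> e; apply: eq_bigr => i _; rewrite e. Qed.

Lemma eq_bform w u v : u =1 v -> bform c w u = bform c w v.
Proof. by move=> e; apply: eq_bigr => i _; rewrite e. Qed.

Lemma qform_morph (S : comNzRingType) (h : {rmorphism R -> S}) v :
  qform (h \o c) (h \o v) = h (qform c v).
Proof.
by rewrite rmorph_sum; apply: eq_bigr => i _; rewrite rmorphM rmorphXn.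
Qed.

Lemma bform_morph (S : comNzRingType) (h : {rmorphism R -> S}) u v :
  bform (h \o c) (h \o u) (h \o v) = h (bform c u v).
Proof. by rewrite rmorph_sum; apply: eq_bigr => i _; rewrite !rmorphM. Qed.

End FormTheory.

Lemma coef_sqr_top (R : comNzRingType) (p : {poly R}) N :
  (size p <= N.+1)%N -> (p ^+ 2)`_(N + N) = p`_N ^+ 2.
Proof.
move=> sp; rewrite expr2 coefM.
have lN : (N < (N + N).+1)%N by rewrite ltnS leq_addr.
rewrite (bigD1 (Ordinal lN)) //= addnK big1 ?addr0 // => i.
rewrite -val_eqE /= => neq.
have [lt|lt|e] := ltngtP i N; last by rewrite e eqxx in neq.
- by rewrite [p`_(_ - _)]nth_default ?mulr0 // (leq_trans sp) // ltn_subRL ltn_add2r.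
- by rewrite [p`__]nth_default ?mul0r // (leq_trans sp).
Qed.

(** The coefficients of highest degree of the [f i] form a vector over [F];
    anisotropy keeps its value, which is the top coefficient of the form, away
    from 0.  Hence the degree of a value is twice the degree of the vector. *)
Lemma anisotropic_size (F : fieldType) n (c : 'I_n -> F) (f : 'I_n -> {poly F}) m :
  anisotropic c -> (size (qform (polyC \o c) f) <= m + m)%N ->
  forall i, (size (f i) <= m)%N.
Proof.
move=> an sq.
have key : forall M, (forall i, size (f i) <= M)%N -> forall i, (size (f i) <= m)%N.
  elim=> [|N IH] sf i; first exact: leq_trans (sf i) _.
  have [lNm|lmN] := ltnP N m; first exact: leq_trans (sf i) _.
  apply: IH => j; have c0 : qform c (fun i => (f i)`_N) = 0.
    have: (qform (polyC \o c) f)`_(N + N) = 0.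
      by rewrite nth_default // (leq_trans sq) // leq_add.
    move=> e; rewrite -[RHS]e coef_sum; apply: eq_bigr => k _ /=.
    by rewrite coefCM coef_sqr_top ?sf.
  have := sf j; rewrite leq_eqVlt ltnS => /orP[/eqP e|//].
  have := an _ c0 j => /= /eqP.
  have -> : N = (size (f j)).-1 by rewrite e.
  by rewrite lead_coef_eq0 => /eqP fj; move: e; rewrite fj size_poly0.
by apply: (key (\max_i size (f i))) => i; apply: leq_bigmax.
Qed.

Lemma fraction_as_quotient (R : idomainType) (x : {fraction R}) :
  exists p q : R, q != 0 /\ x * q%:F = p%:F.
Proof.
elim/quotW: x => r; exists \n_r, \d_r; split; first exact: denom_ratioP.
rewrite -[LHS]/(FracField.mul _ _) !piE; apply/eqmodP.
rewrite /= FracField.equivfE /FracField.mulf.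
by rewrite !numden_Ratio ?mulf_neq0 ?denom_ratioP ?oner_eq0 // !mulr1 mulrC.
Qed.

Lemma fraction_common_denominator (R : idomainType) n (v : 'I_n -> {fraction R}) :
  exists (f : 'I_n -> R) (g : R), g != 0 /\ forall i, v i * g%:F = (f i)%:F.
Proof.
have [m vm] := choice (fun i => fraction_as_quotient (v i)).
have [d vd] := choice vm.
exists (fun i => m i * \prod_(j | j != i) d j), (\prod_j d j); split.
  by apply/prodf_neq0 => i _; case: (vd i).
move=> i; rewrite (bigD1 i) //= !tofracM mulrA.
by have [_ ->] := vd i.
Qed.

Lemma anisotropic_fraction (R : idomainType) n (c : 'I_n -> R) :
  anisotropic c -> anisotropic (tofrac \o c).
Proof.
move=> an v v0; have [f [g [g0 vf]]] := fraction_common_denominator v.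
have: qform (tofrac \o c) (fun i => g%:F * v i) = 0 by rewrite qformZ v0 mulr0.
rewrite (eq_qform _ (v := tofrac \o f)); last by move=> i; rewrite mulrC vf.
rewrite qform_morph => /eqP; rewrite tofrac_eq0 => /eqP/an f0 i.
have /eqP := vf i; rewrite f0 tofrac0 mulf_eq0 tofrac_eq0 (negPf g0) orbF.
by move/eqP.
Qed.

Definition ratC (F : fieldType) : F -> {fraction {poly F}} := tofrac \o polyC.
Arguments ratC {F} _.
HB.instance Definition _ (F : fieldType) := GRing.RMorphism.copy (@ratC F) (tofrac \o polyC).

Section AnisotropicTransfer.

Variables (F : fieldType) (n : nat) (c : 'I_n -> F).
Hypothesis c_an : anisotropic c.

Lemma anisotropic_poly : anisotropic (polyC \o c).
Proof.
move=> f f0 i; apply/eqP; rewrite -size_poly_leq0.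
by apply: (anisotropic_size (m := 0) c_an); rewrite f0 size_poly0.
Qed.

Lemma anisotropic_ratfun : anisotropic (fun i => ratC (c i)).
Proof. exact: anisotropic_fraction anisotropic_poly. Qed.

End AnisotropicTransfer.

(** * The Cassels-Pfister theorem *)

(** Among all representations [f / g] of [d], the denominator [g] can always be
    lowered unless it divides [f].  The point [f / g] of the quadric
    [qform C = d] is close to the polynomial vector [h = f %/ g]: the line
    through both meets the quadric in a second point [f' / g'], and
    [g * g'] is the value of the form at the remainder [f %% g], so that [g'] has
    smaller degree than [g].  The orthogonality to a constant vector [w]
    passes through the construction; it serves to run the theorem inside the
    orthogonal complement of a vector defined over [F]. *)
Lemma cassels_pfister (F : fieldType) n (c w : 'I_n -> F) (d : {poly F})
    (v : 'I_n -> {fraction {poly F}}) :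
  anisotropic c ->
  qform (fun i => ratC (c i)) v = d%:F ->
  bform (fun i => ratC (c i)) (fun i => ratC (w i)) v = 0 ->
  exists f : 'I_n -> {poly F},
    qform (polyC \o c) f = d /\ bform (polyC \o c) (polyC \o w) f = 0.
Proof.
move=> an vd vw; have [f [g [g0 vf]]] := fraction_common_denominator v.
set C := polyC \o c; set W := polyC \o w.
have fE : (fun i => (f i)%:F) =1 (fun i => g%:F * v i) by move=> i; rewrite mulrC.
have {vd}: qform C f = d * g ^+ 2.
  apply/eqP; rewrite -tofrac_eq -qform_morph /=; apply/eqP.
  rewrite [LHS](eq_qform _ fE) qformZ [X in _ * X]vd tofracM tofracXn mulrC //.
have {vw}: bform C W f = 0.
  apply/eqP; rewrite -tofrac_eq0 -bform_morph /=; apply/eqP.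
  by rewrite [LHS](eq_bform _ _ fE) bformZr [X in _ * X]vw mulr0.
have [N] := ubnP (size g); elim: N g f g0 {v vf fE} => // N IH g f g0 sg fw fd.
pose h i := f i %/ g; pose r i := f i %% g.
have fE : f =1 (fun i => g * h i + 1 * r i).
  by move=> i; rewrite mul1r [g * _]mulrC -divp_eq.
have rE : r =1 (fun i => 1 * f i + (- g) * h i) by move=> i; rewrite fE; ring.
(* the value of a constant linear form at the remainder is divisible by [g] and
   has smaller degree *)
have rw : bform C W r = 0.
  have lt : (size (bform C W r) < size g)%N.
    have gp : (0 < size g)%N by rewrite size_poly_gt0.
    rewrite -(prednK gp) ltnS; apply: (leq_trans (size_sum _ _ _)).
    apply/bigmax_leqP => i _; rewrite /C /W /= -polyCM mul_polyC.
    by rewrite (leq_trans (size_scale_leq _ _)) // -ltnS (prednK gp) ltn_modp.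
  rewrite -(modp_small lt) (eq_bform _ _ rE) bform_comb fw mulr0 add0r.
  by rewrite mulNr -mulrN modp_mulr.
have hw : bform C W h = 0.
  have := fw; rewrite (eq_bform _ _ fE) bform_comb rw mulr0 addr0 => /eqP.
  by rewrite mulf_eq0 (negPf g0) => /eqP.
have [r0|nr0] := boolP [forall i, r i == 0].
  exists h; split=> //; apply: (mulfI (expf_neq0 2 g0)).
  rewrite mulrC [RHS]mulrC -fd mulrC -qformZ; apply: eq_qform => i.
  by rewrite fE (eqP (forallP r0 i)); ring.
(* [f' / g'] is the second intersection of the quadric with the line through
   [f / g] and [h]; anisotropy keeps [g'] away from 0 *)
pose a := qform C h - d; pose b := d * g - bform C f h.
pose g' := a * g + 2 * b; pose f' i := a * f i + 2 * b * h i.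
have gg' : g * g' = qform C r.
  rewrite (eq_qform _ rE) qform_comb fd /g' /a /b; ring.
have g'0 : g' != 0.
  apply: contraNneq nr0 => g'0; apply/forallP => i; apply/eqP.
  by apply: (anisotropic_poly an); rewrite -gg' g'0 mulr0.
apply: (IH g' f' g'0).
- have gp : (0 < size g)%N by rewrite size_poly_gt0.
  have le : (size (g * g')%R <= ((size g).-1).*2)%N.
    rewrite gg'; apply: (leq_trans (size_sum _ _ _)).
    apply/bigmax_leqP => i _; rewrite /C /= mul_polyC.
    rewrite (leq_trans (size_scale_leq _ _)) //.
    have [->|ri0] := eqVneq (r i) 0; first by rewrite expr0n size_poly0.
    have := size_poly_exp_leq (r i) 2.
    have : (size (r i) <= (size g).-1)%N by rewrite -ltnS (prednK gp) ltn_modp.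
    have := ri0; rewrite -size_poly_gt0.
    move: (size (r i ^+ 2)%R) (size (r i)) (size g) gp => z x y; lia.
  have := g'0; rewrite -size_poly_gt0 => g'p.
  move: le sg; rewrite size_mul //; lia.
- by rewrite /f' bform_comb fw hw !mulr0 addr0.
- by rewrite /f' qform_comb fd /g' /a /b; ring.
Qed.

(** * Norm forms and pure quaternions *)

Definition vec3 (R : comNzRingType) (x y z : R) : 'I_3 -> R :=
  fun i => nth 0 [:: x; y; z] i.

Definition vec4 (R : comNzRingType) (x y z t : R) : 'I_4 -> R :=
  fun i => nth 0 [:: x; y; z; t] i.

(** The square of [x i + y j + z ij] in the algebra [(a, s)]. *)
Definition pure_form (R : comNzRingType) (a s : R) : 'I_3 -> R :=
  vec3 a s (- (a * s)).

(** The reduced norm of [(a, s)] in the basis [1], [i], [j], [ij]. *)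
Definition norm_form (R : comNzRingType) (a s : R) : 'I_4 -> R :=
  vec4 1 (- a) (- s) (a * s).

Section Vec.

Variable R : comNzRingType.

Lemma vec3_eta (v : 'I_3 -> R) : exists x y z, v = vec3 x y z.
Proof.
exists (v ord0), (v (lift ord0 ord0)), (v (lift ord0 (lift ord0 ord0))).
apply: funext => -[[|[|[|m]]] lm] //; rewrite /vec3 /=; congr v; exact: val_inj.
Qed.

Lemma vec4_eta (v : 'I_4 -> R) : exists x y z t, v = vec4 x y z t.
Proof.
exists (v ord0), (v (lift ord0 ord0)), (v (lift ord0 (lift ord0 ord0))),
  (v (lift ord0 (lift ord0 (lift ord0 ord0)))).
apply: funext => -[[|[|[|[|m]]]] lm] //; rewrite /vec4 /=; congr v; exact: val_inj.
Qed.

Lemma pure_formE (a s x y z : R) :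
  qform (pure_form a s) (vec3 x y z) = a * x ^+ 2 + s * y ^+ 2 - a * s * z ^+ 2.
Proof. by rewrite /qform !big_ord_recl big_ord0 /pure_form /vec3 /=; ring. Qed.

Lemma pure_bformE (a s x y z x' y' z' : R) :
  bform (pure_form a s) (vec3 x y z) (vec3 x' y' z') =
  a * x * x' + s * y * y' - a * s * z * z'.
Proof. by rewrite /bform !big_ord_recl big_ord0 /pure_form /vec3 /=; ring. Qed.

Lemma norm_formE (a s x y z t : R) :
  qform (norm_form a s) (vec4 x y z t) =
  x ^+ 2 - a * y ^+ 2 - s * z ^+ 2 + a * s * t ^+ 2.
Proof. by rewrite /qform !big_ord_recl big_ord0 /norm_form /vec4 /=; ring. Qed.

Lemma norm_bformE (a s x y z t x' y' z' t' : R) :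
  bform (norm_form a s) (vec4 x y z t) (vec4 x' y' z' t') =
  x * x' - a * y * y' - s * z * z' + a * s * t * t'.
Proof. by rewrite /bform !big_ord_recl big_ord0 /norm_form /vec4 /=; ring. Qed.

Lemma vec4_morph (S : comNzRingType) (h : {rmorphism R -> S}) x y z t :
  h \o vec4 x y z t = vec4 (h x) (h y) (h z) (h t).
Proof. by apply: funext => -[[|[|[|[|m]]]] lm]. Qed.

Lemma pure_form_morph (S : comNzRingType) (h : {rmorphism R -> S}) a s :
  h \o pure_form a s = pure_form (h a) (h s).
Proof.
by apply: funext => -[[|[|[|m]]] lm] //; rewrite /= /pure_form /vec3 /= rmorphN rmorphM.
Qed.

Lemma norm_form_morph (S : comNzRingType) (h : {rmorphism R -> S}) a s :
  h \o norm_form a s = norm_form (h a) (h s).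
Proof.
by rewrite vec4_morph rmorph1 !rmorphN rmorphM.
Qed.

Lemma anisotropic_vec4 (a s : R) :
  anisotropic (norm_form a s) <->
  forall x y z t, x ^+ 2 - a * y ^+ 2 - s * z ^+ 2 + a * s * t ^+ 2 = 0 ->
    [/\ x = 0, y = 0, z = 0 & t = 0].
Proof.
split=> [an x y z t|an v].
  rewrite -norm_formE => /an v0.
  by split; [have := v0 (@Ordinal 4 0 isT) | have := v0 (@Ordinal 4 1 isT)
           | have := v0 (@Ordinal 4 2 isT) | have := v0 (@Ordinal 4 3 isT)].
have [x [y [z [t ->]]]] := vec4_eta v.
by rewrite norm_formE => /an[-> -> -> ->] [[|[|[|[|m]]]] lm].
Qed.

Lemma anisotropic_pure (a s : R) :
  anisotropic (norm_form a s) -> anisotropic (pure_form a s).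
Proof.
move/anisotropic_vec4 => an v; have [x [y [z ->]]] := vec3_eta v.
rewrite pure_formE => e; have [|_ -> -> -> i] := an 0 x y z.
  by rewrite -[RHS]oppr0 -[X in _ = - X]e; ring.
by case: i => [[|[|[|m]]] lm].
Qed.

End Vec.

(** * Countability *)

Definition enumerable (T : Type) := exists code : T -> nat, injective code.

Lemma enumerable_image (S T : Type) (g : S -> T) :
  enumerable S -> (forall y, exists x, y = g x) -> enumerable T.
Proof.
move=> [code ci] surj; have [r rE] := choice surj.
exists (code \o r) => x y /ci e; rewrite (rE x) (rE y) e //.
Qed.

Lemma enumerable_prod (S T : Type) : enumerable S -> enumerable T -> enumerable (S * T).
Proof.
move=> [f fi] [g gi]; exists (fun x => pickle (f x.1, g x.2)).
by move=> [x y] [x' y'] /(pcan_inj pickleK)[/fi -> /gi ->].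
Qed.

Lemma enumerable_poly (R : nzRingType) : enumerable R -> enumerable {poly R}.
Proof.
move=> [f fi]; exists (fun p : {poly R} => pickle (map f p)).
by move=> p q /(pcan_inj pickleK)/(inj_map fi)/poly_inj.
Qed.

Lemma enumerable_ratfun (F : fieldType) : enumerable F -> enumerable {fraction {poly F}}.
Proof.
move=> /enumerable_poly eF; have eFF := enumerable_prod eF eF.
apply: (enumerable_image (g := fun pq => pq.1%:F / pq.2%:F) eFF) => x.
have [p [q [q0 xq]]] := fraction_as_quotient x.
by exists (p, q); rewrite -xq mulfK // tofrac_eq0.
Qed.

Lemma enumerable_sigT (T : nat -> Type) :
  (forall n, enumerable (T n)) -> enumerable {n & T n}.
Proof.
move=> eT; pose code n := sval (cid (eT n)).
have ci n : injective (code n) := svalP (cid (eT n)).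
exists (fun nx => pickle (tag nx, code (tag nx) (tagged nx))).
move=> [n x] [m y] /(pcan_inj pickleK)[/= nm].
by case: m / nm y => y /ci ->.
Qed.

Lemma enumerable_surj (T : Type) :
  enumerable T -> T -> exists e : nat -> T, forall y, exists n, e n = y.
Proof.
move=> [code ci] x0.
have key n : exists x, forall y, code y = n -> x = y.
  have [[y <-]|no] := pselect (exists y, code y = n); first by exists y => z /ci.
  by exists x0 => y yn; case: no; exists y.
have [e eE] := choice key; exists e => y; exists (code y); exact: eE.
Qed.

(** * Adjoining a square root *)

(** An isotropic vector [p + z q] gives [N(p) + d N(q) = 0] and
    [B(p, q) = 0], unless [z] already lies in [F].  The quaternion
    [p q^-1] then has norm [-d], and it is pure because its trace is
    proportional to [B(p, q)]; so its square is [d]. *)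
Lemma norm_form_sqrt_ext (F L : fieldType) (h : {rmorphism F -> L}) (z : L) (a s d : F) :
  (2 : F) != 0 -> z ^+ 2 = h d -> (forall y, exists u v, y = h u + z * h v) ->
  anisotropic (norm_form a s) -> (forall v, qform (pure_form a s) v <> d) ->
  anisotropic (norm_form (h a) (h s)).
Proof.
move=> two0 z2 span an nrep y y0.
have [p yp] := choice (fun i => span (y i)); have [q {}yp] := choice yp.
have {}yp : y =1 (fun i => 1 * (h \o p) i + z * (h \o q) i).
  by move=> i; rewrite mul1r yp.
have : h (qform (norm_form a s) p + d * qform (norm_form a s) q) +
       z * h (2 * bform (norm_form a s) p q) = 0.
  rewrite -[RHS]y0 (eq_qform _ yp) -norm_form_morph qform_comb !qform_morph bform_morph.
  by rewrite z2 !rmorphD !rmorphM /= rmorph_nat; ring.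
have [B0|nB0] := eqVneq (bform (norm_form a s) p q) 0.
  rewrite B0 mulr0 rmorph0 mulr0 addr0 => /eqP; rewrite fmorph_eq0 => /eqP.
  have [q0|nq0] := eqVneq (qform (norm_form a s) q) 0.
    rewrite q0 mulr0 addr0 => p0 i.
    by rewrite yp /= (an _ p0) (an _ q0) rmorph0 !mulr0 addr0.
  move=> e; exfalso; move: B0 nq0 e.
  have [p0 [p1 [p2 [p3 ->]]]] := vec4_eta p.
  have [q0 [q1 [q2 [q3 ->]]]] := vec4_eta q.
  rewrite norm_bformE !norm_formE.
  set N := q0 ^+ 2 - _ - _ + _ => B0 nN e.
  (* [I], [J], [K] are the pure coordinates of [p] times the conjugate of [q] *)
  pose I := p1 * q0 - p0 * q1 + s * (p2 * q3 - p3 * q2).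
  pose J := p2 * q0 - p0 * q2 + a * (p3 * q1 - p1 * q3).
  pose K := p3 * q0 - p0 * q3 - p1 * q2 + p2 * q1.
  have key : a * I ^+ 2 + s * J ^+ 2 - a * s * K ^+ 2 = d * N ^+ 2.
    transitivity ((p0 * q0 - a * p1 * q1 - s * p2 * q2 + a * s * p3 * q3) ^+ 2
      - (p0 ^+ 2 - a * p1 ^+ 2 - s * p2 ^+ 2 + a * s * p3 ^+ 2 + d * N) * N
      + d * N ^+ 2); first by rewrite /I /J /K /N; ring.
    by rewrite B0 e; ring.
  apply: (nrep (vec3 (I / N) (J / N) (K / N))); rewrite pure_formE.
  move: nN key; move: (N) (I) (J) (K) => N' I' J' K' nN key.
  by apply: (mulIf (expf_neq0 2 nN)); rewrite -key; field.
(* from here on [p] and [q] are not orthogonal, which forces [z] into [F] *)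
have [[e ze]|nsq] := pselect (exists e, z = h e).
  have hy i : y i = h (p i + e * q i) by rewrite yp ze rmorphD rmorphM /=; ring.
  move=> _ i; rewrite hy; move: y0.
  rewrite (eq_qform _ hy) -norm_form_morph -[X in qform _ X]/(h \o _) qform_morph.
  by move/eqP; rewrite fmorph_eq0 => /eqP/an ->; rewrite rmorph0.
have nB2 : 2 * bform (norm_form a s) p q != 0 by rewrite mulf_neq0.
move: nB2; move: (_ + _) (2 * _) => A B nB2 e; case: nsq.
exists (- A / B); rewrite rmorphM rmorphN fmorphV.
have hB : h B != 0 by rewrite fmorph_eq0.
by apply: (mulIf hB); rewrite divfK //; apply/eqP; rewrite -addr_eq0 addrC e.
Qed.

(** When [d] is already a square the extension is [F] itself, and [u], [v] are
    not unique. *)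
Lemma sqrt_extension (F : fieldType) (d : F) :
  exists (L : fieldType) (h : {rmorphism F -> L}) (z : L),
    z ^+ 2 = h d /\ forall y, exists u v, y = h u + z * h v.
Proof.
have [[e de]|nsq] := pselect (exists e, e ^+ 2 = d).
  by exists F, idfun, e; split=> // y; exists y, 0; rewrite mulr0 addr0.
have irr : irreducible_poly ('X^2 - d%:P).
  have sp : size ('X^2 - d%:P) = 3%N by rewrite size_XnsubC.
  apply: cubic_irreducible; first by rewrite sp.
  move=> x; apply/negP; rewrite /root !hornerE subr_eq0 => /eqP e.
  by apply: nsq; exists x.
have [L dimL [z rz Lz]] := irredp_FAdjoin irr.
have z2 : z ^+ 2 = d%:A.
  apply/eqP; rewrite -subr_eq0; move: rz.
  by rewrite /root rmorphB /= map_polyXn map_polyC /= !hornerE.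
exists L, (in_alg L), z; split=> //.
have sub : (<<1; z>> <= 1 + <[z]>)%VS.
  apply: agenv_sub_modl; first exact: addvSl.
  rewrite prodvDl prod1v prodvDr prodv1 prodv_line -expr2 z2 subv_add subvv /=.
  rewrite subv_add addvSr /= (subv_trans _ (addvSl _ _)) // -memvE.
  exact/memvZ/mem1v.
move=> y; have /(subvP sub)/memv_addP[_ /vlineP[u ->]] : y \in <<1; z>>%VS.
  by rewrite Lz memvf.
case=> _ /vlineP[v ->] ->; exists u, v.
by rewrite /= -scalerAr mulr1.
Qed.

(** * Generic values of pure forms *)

Lemma quadratic_poly_inj (R : nzRingType) (a b c a' b' c' : R) :
  a%:P * 'X^2 + b%:P * 'X + c%:P = a'%:P * 'X^2 + b'%:P * 'X + c'%:P ->
  [/\ a = a', b = b' & c = c'].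
Proof.
move=> e; have ek k := congr1 (fun p : {poly R} => p`_k) e.
split; [move: (ek 2) | move: (ek 1) | move: (ek 0)];
  by rewrite !coefD !coefCM !coefXn !coefX !coefC /= !(mulr0, mulr1, addr0, add0r).
Qed.

Lemma quadratic_poly_neq0 (R : nzRingType) (a b : R) :
  a != 0 -> a%:P * 'X^2 + b%:P != 0.
Proof.
apply: contra_neq => e; have [|-> //] := @quadratic_poly_inj _ a 0 b 0 0 0.
by rewrite polyC0 !mul0r !addr0.
Qed.

(** After clearing denominators the representing vector has degree at most 1 by
    [anisotropic_size]; the conclusion compares the coefficients of its value.
    The case [al = 0] descends a represented constant from [F(x)] to [F]. *)
Lemma ratfun_represents_quadratic (F : fieldType) n (c w : 'I_n -> F) (al ga : F)
    (v : 'I_n -> {fraction {poly F}}) :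
  anisotropic c ->
  qform (fun i => ratC (c i)) v = (al%:P * 'X^2 + ga%:P)%:F ->
  bform (fun i => ratC (c i)) (fun i => ratC (w i)) v = 0 ->
  exists u1 u0 : 'I_n -> F,
    [/\ qform c u1 = al, qform c u0 = ga, 2 * bform c u1 u0 = 0,
        bform c w u1 = 0 & bform c w u0 = 0].
Proof.
move=> an vd vw; have [f [fd fw]] := cassels_pfister an vd vw.
have sf i : (size (f i) <= 2)%N.
  apply: (anisotropic_size an); rewrite fd.
  rewrite (leq_trans (size_polyD _ _)) // geq_max mul_polyC.
  rewrite (leq_trans (size_scale_leq _ _)) ?size_polyXn //=.
  by rewrite (leq_trans (size_polyC_leq1 _)).
pose u0 i := (f i)`_0; pose u1 i := (f i)`_1.
have fE : f =1 (fun i => 'X * (polyC \o u1) i + 1 * (polyC \o u0) i).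
  move=> i; apply/polyP => -[|[|k]]; rewrite coefD mulrC coefMX mul1r !coefC ?add0r ?addr0 //=.
  by rewrite nth_default // (leq_trans (sf i)).
move: fd fw; rewrite (eq_qform _ fE) (eq_bform _ _ fE) qform_comb bform_comb.
rewrite !qform_morph !bform_morph /= => fd fw.
exists u1, u0.
have [|-> e ->] := @quadratic_poly_inj _ (qform c u1) (2 * bform c u1 u0)
  (qform c u0) al 0 ga.
  by rewrite polyC0 mul0r addr0 -fd polyCM polyC_natr; ring.
have [|_ wu1 wu0] := @quadratic_poly_inj _ 0 (bform c w u1) (bform c w u0) 0 0 0.
  by rewrite !polyC0 !mul0r !addr0 add0r -fw; ring.
by [].
Qed.

(** The reflection along [u - v] exchanges [u] and [v], and it is defined because
    the form is anisotropic; it carries [w] to a vector orthogonal to [v]. *)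
Lemma reflect_orthogonal (F : fieldType) n (c u v w : 'I_n -> F) :
  anisotropic c -> qform c u = qform c v -> bform c w u = 0 ->
  exists w', qform c w' = qform c w /\ bform c v w' = 0.
Proof.
move=> an euv wu.
pose e i := 1 * u i + (-1) * v i.
have qe : qform c e = 2 * qform c v - 2 * bform c u v.
  by rewrite qform_comb euv; ring.
have [e0|ne0] := eqVneq (qform c e) 0.
  exists w; split=> //; rewrite bformC -wu; apply: eq_bform => i.
  by have := an _ e0 i; rewrite /e mul1r mulN1r => /eqP; rewrite subr_eq0 => /eqP.
have we : bform c w e = - bform c w v by rewrite bform_comb wu; ring.
have ve : bform c v e = bform c u v - qform c v.
  rewrite bform_comb [bform c v u]bformC.
  suff -> : bform c v v = qform c v by ring.
  by apply: eq_bigr => i _; rewrite -mulrA expr2.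
exists (fun i => 1 * w i + (- 2 * bform c w e / qform c e) * e i); split.
  by rewrite qform_comb; field.
rewrite bform_comb [bform c v w]bformC ve we.
by move: ne0; rewrite qe => ne0; field.
Qed.

(** The Gram determinant of three vectors is the determinant [-(as)^2] of the
    form times a square. *)
Lemma pure_form_gram (R : comNzRingType) (a s : R) (u v w : 'I_3 -> R) :
  bform (pure_form a s) u v = 0 -> bform (pure_form a s) u w = 0 ->
  bform (pure_form a s) v w = 0 ->
  exists r, qform (pure_form a s) u * qform (pure_form a s) v * qform (pure_form a s) w
            = - r ^+ 2.
Proof.
have [u0 [u1 [u2 ->]]] := vec3_eta u; have [v0 [v1 [v2 ->]]] := vec3_eta v.
have [w0 [w1 [w2 ->]]] := vec3_eta w.
rewrite !pure_bformE !pure_formE => uv uw vw.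
exists (a * s * (u0 * (v1 * w2 - v2 * w1) - u1 * (v0 * w2 - v2 * w0)
                 + u2 * (v0 * w1 - v1 * w0))).
set A := a * u0 ^+ 2 + _ - _; set B := a * v0 ^+ 2 + _ - _; set C := a * w0 ^+ 2 + _ - _.
set X := a * u0 * v0 + _ - _ in uv; set Y := a * u0 * w0 + _ - _ in uw.
set Z := a * v0 * w0 + _ - _ in vw.
(* the Gram determinant, without using orthogonality *)
transitivity (A * B * C + 2 * X * Y * Z - A * Z ^+ 2 - B * Y ^+ 2 - C * X ^+ 2).
  by rewrite uv uw vw; ring.
by rewrite /A /B /C /X /Y /Z; ring.
Qed.

Section GenericValue.

Variables (K : fieldType) (a s a' b c : K).
Hypotheses (two0 : (2 : K) != 0) (an : anisotropic (norm_form a s)).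
Hypotheses (b0 : b != 0) (c0 : c != 0) (nsq : forall e, e ^+ 2 <> a').

(** [a'] times the generic value [b x^2 + c y^2 - bc] of [<b, c, -bc>], with
    [x] the outer and [y] the inner variable.  Adjoining its square root makes
    [a'] a value of [<b, c, -bc>]. *)
Definition generic_value : {fraction {poly {fraction {poly K}}}} :=
  ((ratC (a' * b))%:P * 'X^2
   + (((a' * c)%:P * 'X^2 + (- (a' * b * c))%:P)%:F)%:P)%:F.

(** A representation over [K(y)(x)] is linear in [x], so it yields orthogonal
    [q1], [q0] over [K(y)] with values [a'b] and [a'c y^2 - a'bc].  A vector
    [i] over [K] also has the value [a'b]; a reflection moves [q1] to [i] and
    [q0] into the orthogonal complement of [i].  There the representation is
    linear in [y] and yields [r1], [r0] over [K].  The Gram determinant of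
    [r1], [r0], [i] shows that [a' (a'bc)^2] is a square. *)
Lemma generic_value_not_represented v :
  qform (pure_form (ratC (ratC a)) (ratC (ratC s))) v <> generic_value.
Proof.
have a'0 : a' != 0 by apply/eqP => e; apply: (nsq (e := 0)); rewrite e expr0n.
have anK := anisotropic_pure an; have anF := anisotropic_ratfun anK.
set phi := pure_form a s in anK anF.
have bz (F : comNzRingType) n (d u : 'I_n -> F) : bform d (fun=> 0) u = 0.
  by apply: big1 => i _; rewrite mulr0 mul0r.
have bz' (F : fieldType) n (d : 'I_n -> {fraction {poly F}}) u :
    bform d (fun=> ratC 0) u = 0.
  by rewrite rmorph0 bz.
rewrite -!pure_form_morph => vd.
have [q1 [q0 [q1E q0E q10 _ _]]] :=
  @ratfun_represents_quadratic _ _ _ (fun=> 0) _ _ _ anF vd (bz' _ _ _ _).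
have q1E' : qform (ratC \o phi) q1 = (0%:P * 'X^2 + (a' * b)%:P)%:F.
  by rewrite q1E polyC0 mul0r add0r.
have [_ [i [_ iE _ _ _]]] :=
  @ratfun_represents_quadratic _ _ _ (fun=> 0) _ _ _ anK q1E' (bz' _ _ _ _).
have {}q10 : bform (ratC \o phi) q0 q1 = 0.
  have two0' : (2 : {fraction {poly K}}) != 0.
    by rewrite -(rmorph_nat (@ratC K)) fmorph_eq0.
  by rewrite bformC; apply/eqP; rewrite -(mulrI_eq0 _ (mulfI two0')) q10.
have qE : qform (ratC \o phi) q1 = qform (ratC \o phi) (ratC \o i).
  by rewrite q1E qform_morph iE.
have [q [q0E' qi]] := reflect_orthogonal anF qE q10.
rewrite q0E in q0E'.
have [r1 [r0 [r1E r0E r10 ir1 ir0]]] := ratfun_represents_quadratic anK q0E' qi.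
have {}r10 : bform phi r1 r0 = 0.
  by apply/eqP; rewrite -(mulrI_eq0 _ (mulfI two0)) r10.
have [r] := pure_form_gram ir1 ir0 r10.
rewrite r1E r0E iE => e; apply: (nsq (e := r / (a' * b * c))).
have D0 : a' * b * c != 0 by rewrite !mulf_neq0.
apply: (mulIf (expf_neq0 2 D0)); rewrite -exprMn divfK //.
by apply: oppr_inj; rewrite -e; ring.
Qed.

End GenericValue.

Lemma pure_value_of_sqrt (K F L : fieldType) (j : {rmorphism K -> F})
    (h : {rmorphism F -> L}) (a' b c : K) (x y : F) (z : L) :
  z ^+ 2 = h (j (a' * b) * x ^+ 2 + j (a' * c) * y ^+ 2 - j (a' * b * c)) ->
  z != 0 -> a' != 0 ->
  exists v, qform (pure_form (h (j b)) (h (j c))) v = h (j a').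
Proof.
move=> z2 z0 a'0.
exists (vec3 (h x * h (j a') / z) (h y * h (j a') / z) (h (j a') / z)).
have {}z2 : z ^+ 2 = h (j a') * (h (j b) * h x ^+ 2 + h (j c) * h y ^+ 2
                                 - h (j b) * h (j c)).
  by rewrite z2 !(rmorphD, rmorphM, rmorphXn, rmorphN); ring.
rewrite pure_formE; apply: (mulIf (expf_neq0 2 z0)); rewrite [in RHS]z2.
by field.
Qed.

Definition preserves_norm_forms (K L : fieldType) (h : {rmorphism K -> L}) :=
  forall a s, anisotropic (norm_form a s) -> anisotropic (norm_form (h a) (h s)).

(** The extension depends only on [a'], [b] and [c], yet it preserves the
    anisotropy of all norm forms over [K] simultaneously. *)
Lemma solving_extension (K : fieldType) (a' b c : K) :
  (2 : K) != 0 -> b != 0 -> c != 0 -> (forall e, e ^+ 2 <> a') ->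
  exists (L : fieldType) (h : {rmorphism K -> L}),
    (exists v, qform (pure_form (h b) (h c)) v = h a') /\
    preserves_norm_forms h /\ (enumerable K -> enumerable L).
Proof.
move=> two0 b0 c0 nsq; pose F : fieldType := {fraction {poly {fraction {poly K}}}}.
have [L [h [z [z2 span]]]] := sqrt_extension (generic_value a' b c).
pose j : {rmorphism K -> F} := (@ratC _ \o @ratC K)%FUN.
have two0F : (2 : F) != 0 by rewrite -(rmorph_nat j) fmorph_eq0.
exists L, (h \o j); split; last first.
  split; last first.
    move=> /enumerable_ratfun/enumerable_ratfun eF.
    apply: (enumerable_image (g := fun p => h p.1 + z * h p.2) (enumerable_prod eF eF)).
    by move=> y; have [u [v ->]] := span y; exists (u, v).
  move=> a s an; apply: norm_form_sqrt_ext (two0F) z2 span _ _.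
    rewrite -!norm_form_morph; do 2!apply: anisotropic_ratfun; exact: an.
  exact: generic_value_not_represented.
have d0 : generic_value a' b c != 0.
  rewrite tofrac_eq0 quadratic_poly_neq0 // fmorph_eq0 mulf_neq0 //.
  by apply/eqP => a'0; case: (nsq 0); rewrite a'0 expr0n.
have z0 : z != 0 by apply: contraNneq d0 => z0; rewrite -(fmorph_eq0 h) -z2 z0 expr0n.
pose x : F := ('X : {poly {fraction {poly K}}})%:F.
pose y : F := (('X : {poly K})%:F)%:P%:F.
have dE : generic_value a' b c = j (a' * b) * x ^+ 2 + j (a' * c) * y ^+ 2 - j (a' * b * c).
  rewrite /generic_value tofracD tofracM tofracXn.
  rewrite [(_ + _)%:F]tofracD [(_ * 'X^2)%:F]tofracM [('X^2)%:F]tofracXn.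
  rewrite polyCD polyCM polyC_exp tofracD tofracM tofracXn addrA.
  by rewrite -(rmorphN j).
by rewrite dE in z2; apply: pure_value_of_sqrt z2 z0 _; apply/eqP => a'0;
  apply: (nsq 0); rewrite a'0 expr0n.
Qed.

(** * Unions of towers of fields *)

(** The union of a tower is built from sequences [u], with [u n] in the [n]-th
    field, that eventually follow the transition maps; two of them are
    identified when they eventually agree.  Everything is then defined and
    checked stage by stage, the inverse included, and no transport between the
    stages [m + n] and [n + m] ever occurs. *)
Section TowerUnion.

Variables (K : nat -> fieldType) (f : forall n, {rmorphism K n -> K n.+1}).

Definition eventually (P : nat -> Prop) := exists N, forall n, (N <= n)%N -> P n.

Lemma eventuallyW (P Q : nat -> Prop) :
  (forall n, P n -> Q n) -> eventually P -> eventually Q.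
Proof. by move=> PQ [N HN]; exists N => n /HN/PQ. Qed.

Lemma eventually_and (P Q : nat -> Prop) :
  eventually P -> eventually Q -> eventually (fun n => P n /\ Q n).
Proof.
move=> [N HN] [M HM]; exists (maxn N M) => n; rewrite geq_max => /andP[ln lm].
by split; [apply: HN | apply: HM].
Qed.

Definition coherent (u : forall n, K n) := eventually (fun n => f n (u n) = u n.+1).

Definition thread := {u : forall n, K n | `[< coherent u >]}.

Definition thread_eqv (u v : thread) := `[< eventually (fun n => sval u n = sval v n) >].

Lemma thread_eqv_equiv : equiv_class_of thread_eqv.
Proof.
split=> [u|u v|v u w].
- by apply/asboolP; exists 0%N.
- by apply/idP/idP => /asboolP h; apply/asboolP; apply: eventuallyW h.
- move=> /asboolP uv /asboolP vw; apply/asboolP.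
  by apply: eventuallyW (eventually_and uv vw) => n [-> ->].
Qed.

Canonical thread_equiv_rel := EquivRelPack thread_eqv_equiv.

Definition tower_union := {eq_quot thread_eqv}%qT.

HB.instance Definition _ := Choice.on tower_union.

Definition at_stage (x : tower_union) : forall n, K n := sval (repr x).

Lemma at_stageP x : coherent (at_stage x).
Proof. by rewrite /at_stage; case: (repr x) => u /= /asboolP. Qed.

Lemma tower_union_eq x y : eventually (fun n => at_stage x n = at_stage y n) -> x = y.
Proof.
by move=> /asboolP e; rewrite -[x]reprK -[y]reprK; apply/eqP; rewrite eqmodE.
Qed.

Lemma tower_union_mk u : coherent u ->
  {x : tower_union | eventually (fun n => at_stage x n = u n)}.
Proof.
move=> cu; exists (\pi_(tower_union)%qT (exist _ u (asboolT cu))).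
rewrite /at_stage; case: piP => v /eqP.
by rewrite eqmodE => /asboolP; apply: eventuallyW.
Qed.

Definition tower_lift u (cu : coherent u) : tower_union := sval (tower_union_mk cu).

Lemma coherent_const (c : forall n, K n) : (forall n, f n (c n) = c n.+1) -> coherent c.
Proof. by move=> H; exists 0%N. Qed.

Lemma coherent_opp x : coherent (fun n => - at_stage x n).
Proof. by apply: eventuallyW (at_stageP x) => n e; rewrite rmorphN e. Qed.

Lemma coherent_inv x : coherent (fun n => (at_stage x n)^-1).
Proof. by apply: eventuallyW (at_stageP x) => n e; rewrite fmorphV e. Qed.

Lemma coherent_add x y : coherent (fun n => at_stage x n + at_stage y n).
Proof.
apply: eventuallyW (eventually_and (at_stageP x) (at_stageP y)) => n [ex ey].
by rewrite rmorphD ex ey.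
Qed.

Lemma coherent_mul x y : coherent (fun n => at_stage x n * at_stage y n).
Proof.
apply: eventuallyW (eventually_and (at_stageP x) (at_stageP y)) => n [ex ey].
by rewrite rmorphM ex ey.
Qed.

Definition tower0 := tower_lift (coherent_const (fun n => rmorph0 (f n))).
Definition tower1 := tower_lift (coherent_const (fun n => rmorph1 (f n))).
Definition tower_opp x := tower_lift (coherent_opp x).
Definition tower_inv x := tower_lift (coherent_inv x).
Definition tower_add x y := tower_lift (coherent_add x y).
Definition tower_mul x y := tower_lift (coherent_mul x y).

Lemma at_stage_lift u (cu : coherent u) :
  eventually (fun n => at_stage (tower_lift cu) n = u n).
Proof. exact: svalP (tower_union_mk cu). Qed.

Let at0 := at_stage_lift (coherent_const (fun n => rmorph0 (f n))).
Let at1 := at_stage_lift (coherent_const (fun n => rmorph1 (f n))).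
Let atN x := at_stage_lift (coherent_opp x).
Let atV x := at_stage_lift (coherent_inv x).
Let atD x y := at_stage_lift (coherent_add x y).
Let atM x y := at_stage_lift (coherent_mul x y).

Lemma tower_addA : associative tower_add.
Proof.
move=> x y z; apply: tower_union_eq.
apply: eventuallyW (eventually_and (eventually_and (atD x (tower_add y z)) (atD y z))
  (eventually_and (atD (tower_add x y) z) (atD x y))) => n [[-> ->] [-> ->]].
by rewrite addrA.
Qed.

Lemma tower_addC : commutative tower_add.
Proof.
move=> x y; apply: tower_union_eq.
by apply: eventuallyW (eventually_and (atD x y) (atD y x)) => n [-> ->]; rewrite addrC.
Qed.

Lemma tower_add0 : left_id tower0 tower_add.
Proof.
move=> x; apply: tower_union_eq.
by apply: eventuallyW (eventually_and (atD tower0 x) at0) => n [-> ->]; rewrite add0r.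
Qed.

Lemma tower_addN : left_inverse tower0 tower_opp tower_add.
Proof.
move=> x; apply: tower_union_eq.
apply: eventuallyW (eventually_and (atD (tower_opp x) x) (eventually_and at0 (atN x))).
by move=> n [-> [-> ->]]; rewrite addNr.
Qed.

HB.instance Definition _ :=
  GRing.isZmodule.Build tower_union tower_addA tower_addC tower_add0 tower_addN.

Lemma tower_mulA : associative tower_mul.
Proof.
move=> x y z; apply: tower_union_eq.
apply: eventuallyW (eventually_and (eventually_and (atM x (tower_mul y z)) (atM y z))
  (eventually_and (atM (tower_mul x y) z) (atM x y))) => n [[-> ->] [-> ->]].
by rewrite mulrA.
Qed.

Lemma tower_mulC : commutative tower_mul.
Proof.
move=> x y; apply: tower_union_eq.
by apply: eventuallyW (eventually_and (atM x y) (atM y x)) => n [-> ->]; rewrite mulrC.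
Qed.

Lemma tower_mul1 : left_id tower1 tower_mul.
Proof.
move=> x; apply: tower_union_eq.
by apply: eventuallyW (eventually_and (atM tower1 x) at1) => n [-> ->]; rewrite mul1r.
Qed.

Lemma tower_mulDl : left_distributive tower_mul tower_add.
Proof.
move=> x y z; apply: tower_union_eq.
apply: eventuallyW (eventually_and (eventually_and (atM (tower_add x y) z) (atD x y))
  (eventually_and (atD (tower_mul x z) (tower_mul y z))
                  (eventually_and (atM x z) (atM y z)))) => n [[-> ->] [-> [-> ->]]].
by rewrite mulrDl.
Qed.

Lemma tower1_neq0 : tower1 != tower0.
Proof.
apply/eqP => e; have [N HN] := eventually_and at0 at1.
have [h0 h1] := HN N (leqnn N).
have /eqP[] := oner_neq0 (K N).
by rewrite -[LHS]h1 -[RHS]h0 -/tower1 e.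
Qed.

HB.instance Definition _ :=
  GRing.Zmodule_isComNzRing.Build tower_union tower_mulA tower_mulC tower_mul1
    tower_mulDl tower1_neq0.

Lemma tower_mulV x : x != tower0 -> tower_mul (tower_inv x) x = tower1.
Proof.
move=> x0; have [N HN] := at_stageP x.
(* a coherent thread that vanishes once vanishes from there on *)
have nz n : (N <= n)%N -> at_stage x n != 0.
  move=> Nn; apply: contra x0 => /eqP xn0; apply/eqP/tower_union_eq.
  have [M HM] := at0; exists (maxn n M) => m; rewrite geq_max => /andP[nm Mm].
  rewrite HM // -(subnKC nm); elim: (m - n)%N => [|k IH]; first by rewrite addn0.
  by rewrite addnS -HN ?IH ?rmorph0 // (leq_trans Nn) ?leq_addr.
apply: tower_union_eq.
have nzN : eventually (fun n => at_stage x n != 0) by exists N.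
apply: eventuallyW (eventually_and (eventually_and (atM (tower_inv x) x) (atV x))
  (eventually_and at1 nzN)) => n [[-> ->] [-> xn]].
by rewrite mulVf.
Qed.

Lemma tower_inv0 : tower_inv tower0 = tower0.
Proof.
apply: tower_union_eq.
by apply: eventuallyW (eventually_and (atV tower0) at0) => n [-> ->]; rewrite invr0.
Qed.

HB.instance Definition _ :=
  GRing.ComNzRing_isField.Build tower_union tower_mulV tower_inv0.

End TowerUnion.

Section TowerUnionTheory.

Variables (K : nat -> fieldType) (f : forall n, {rmorphism K n -> K n.+1}).

(** Induction on [n] over all towers: dropping the first field of the tower
    lowers the stage of [x], and the resulting sequence is shifted back. *)
Lemma thread_through n (x : K n) :
  exists u : forall m, K m, u n = x /\ forall m, (n <= m)%N -> f m (u m) = u m.+1.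
Proof.
elim: n K f x => [|n IH] K' f' x.
  by exists (nat_rect K' x (fun m y => f' m y)).
have [u [un uS]] := IH (fun m => K' m.+1) (fun m => f' m.+1) x.
exists (fun m => if m is m'.+1 then u m' else 0); split=> // -[//|m].
by rewrite ltnS => /uS.
Qed.

Theorem tower_union_exists :
  exists (L : fieldType) (h : forall n, {rmorphism K n -> L}),
    (forall n x, h n.+1 (f n x) = h n x) /\ (forall y, exists n x, y = h n x).
Proof.
pose th n x := sval (cid (@thread_through n x)).
have th0 n x : th n x n = x by rewrite /th; case: cid => u [].
have thS n x m : (n <= m)%N -> f m (th n x m) = th n x m.+1.
  by rewrite /th; case: cid => u [? H] /H.
have th_eq n (x : K n) u (un : u n = x)
    (uS : forall m, (n <= m)%N -> f m (u m) = u m.+1) m : (n <= m)%N -> th n x m = u m.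
  move/subnKC <-; elim: (m - n)%N => [|k IH]; first by rewrite addn0 th0.
  by rewrite addnS -thS ?leq_addr // IH uS ?leq_addr.
have thc n x : coherent f (th n x) by exists n => m /thS.
pose h n x : tower_union f := tower_lift (thc n x).
have hE n x : eventually (fun m => at_stage (h n x) m = th n x m) := at_stage_lift _.
have ev n P : (forall m, (n <= m)%N -> P m) -> eventually P by exists n.
have hB n : zmod_morphism (h n).
  move=> x y; apply: tower_union_eq; rewrite -[h n x - _]/(tower_add _ (tower_opp _)).
  have e : eventually (fun m => th n (x - y) m = th n x m - th n y m).
    apply: (ev n); apply: th_eq; first by rewrite !th0.
    by move=> m nm; rewrite rmorphB !thS.
  have atD := at_stage_lift (coherent_add (h n x) (tower_opp (h n y))).
  have atN := at_stage_lift (coherent_opp (h n y)).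
  apply: eventuallyW (eventually_and (eventually_and (hE n (x - y)) e)
    (eventually_and (eventually_and atD atN)
                    (eventually_and (hE n x) (hE n y)))).
  by move=> m [[-> ->] [[-> ->] [-> ->]]].
have hM n : monoid_morphism (h n).
  split=> [|x y]; apply: tower_union_eq.
    have e : eventually (fun m => th n 1 m = 1).
      by apply: (ev n); apply: th_eq => // m _; rewrite rmorph1.
    have at1 := at_stage_lift (coherent_const (fun n => rmorph1 (f n))).
    by apply: eventuallyW (eventually_and (eventually_and (hE n 1) e) at1) => m [[-> ->] ->].
  have e : eventually (fun m => th n (x * y) m = th n x m * th n y m).
    apply: (ev n); apply: th_eq; first by rewrite !th0.
    by move=> m nm; rewrite rmorphM !thS.
  have atM := at_stage_lift (coherent_mul (h n x) (h n y)).
  apply: eventuallyW (eventually_and (eventually_and (hE n (x * y)) e)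
    (eventually_and atM (eventually_and (hE n x) (hE n y)))).
  by move=> m [[-> ->] [-> [-> ->]]].
pose H n : {rmorphism K n -> tower_union f} :=
  HB.pack (h n) (GRing.isZmodMorphism.Build _ _ (h n) (hB n))
                (GRing.isMonoidMorphism.Build _ _ (h n) (hM n)).
exists (tower_union f), H; split=> [n x|y].
  apply: tower_union_eq.
  have e : eventually (fun m => th n.+1 (f n x) m = th n x m).
    apply: (ev n.+1); apply: th_eq => [|m /ltnW/thS//].
    by rewrite -thS // th0.
  by apply: eventuallyW (eventually_and (hE n.+1 (f n x)) (eventually_and (hE n x) e))
    => m [-> [-> ->]].
have [N HN] := at_stageP y; exists N, (at_stage y N); apply: tower_union_eq.
have e : eventually (fun m => th N (at_stage y N) m = at_stage y m).
  by apply: (ev N); apply: th_eq.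
by apply: eventuallyW (eventually_and (hE N (at_stage y N)) e) => m [-> ->].
Qed.

End TowerUnionTheory.

(** * Representing all non-squares *)

(** The property required of the triple [(a', b, c)] once it is viewed over
    [L].  Allowing [a'] to become a square makes the property stable under
    further extensions. *)
Definition represented_after (K L : fieldType) (h : {rmorphism K -> L}) (t : K * K * K) :=
  t.1.2 != 0 -> t.2 != 0 ->
  (exists e, e ^+ 2 = h t.1.1) \/
  (exists v, qform (pure_form (h t.1.2) (h t.2)) v = h t.1.1).

Lemma representing_step (K : fieldType) (t : K * K * K) :
  (2 : K) != 0 -> enumerable K ->
  exists (L : fieldType) (h : {rmorphism K -> L}),
    [/\ enumerable L, preserves_norm_forms h & represented_after h t].
Proof.
move=> two0 eK; have [|no] := pselect (represented_after idfun t).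
  by exists K, idfun; split=> // a s.
have [b0 c0] : t.1.2 != 0 /\ t.2 != 0.
  split; apply/negP => /eqP e0; apply: no.
    by move=> /eqP/(_ e0).
  by move=> _ /eqP/(_ e0).
have nsq e : e ^+ 2 <> t.1.1 by move=> et; apply: no; left; exists e.
have [L [h [hv [hp hE]]]] := solving_extension two0 b0 c0 nsq.
by exists L, h; split=> //; [apply: hE | move=> _ _; right].
Qed.

Record countable_extension (K : fieldType) := CountableExtension {
  ext_field :> fieldType;
  ext_map : {rmorphism K -> ext_field};
  ext_enumerable : enumerable ext_field }.

(** Iterating a one-step construction.  The step may depend on its rank [n]
    and on the map from the base field [K], which lets step [n] treat the
    [n]-th element of an enumeration of data over [K].  Anisotropy passes to
    the union since an isotropic vector has finitely many coordinates and so
    comes from some stage. *)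
Lemma tower_over (K : fieldType)
    (Q : nat -> forall M N : fieldType, {rmorphism K -> M} -> {rmorphism M -> N} -> Prop) :
  (forall n (M : fieldType) (i : {rmorphism K -> M}), enumerable M ->
     exists (N : fieldType) (g : {rmorphism M -> N}),
       [/\ enumerable N, preserves_norm_forms g & Q n M N i g]) ->
  enumerable K ->
  exists (L : fieldType) (j : {rmorphism K -> L}),
    [/\ enumerable L, preserves_norm_forms j &
    exists (M : nat -> fieldType) (i : forall n, {rmorphism K -> M n})
           (g : forall n, {rmorphism M n -> M n.+1}) (h : forall n, {rmorphism M n -> L}),
      [/\ forall n, Q n (M n) (M n.+1) (i n) (g n),
          forall n x, h n.+1 (g n x) = h n x,
          forall n x, h n (i n x) = j x &
          forall y, exists n x, y = h n x]].
Proof.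
move=> step eK.
pose good n (S T : countable_extension K) (g : {rmorphism S -> T}) :=
  [/\ preserves_norm_forms g, Q n S T (ext_map S) g
     & forall x, g (ext_map S x) = ext_map T x].
have next n (S : countable_extension K) :
    {T : countable_extension K & {g : {rmorphism S -> T} | good n S T g}}.
  suff /cid[T /cid gT] : exists (T : countable_extension K) (g : {rmorphism S -> T}),
    good n S T g by exists T.
  have [N [g [eN pg Qg]]] := step n _ (ext_map S) (ext_enumerable S).
  by exists (@CountableExtension K N (g \o ext_map S)%FUN eN), g.
pose S := nat_rect (fun=> countable_extension K) (@CountableExtension K K idfun eK)
                   (fun n S => projT1 (next n S)).
pose g n : {rmorphism S n -> S n.+1} := sval (projT2 (next n (S n))).
have gP n : good n (S n) (S n.+1) (g n) := svalP (projT2 (next n (S n))).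
have [L [h [hg hsurj]]] := tower_union_exists g.
have later n x m : (n <= m)%N -> exists y, h m y = h n x.
  move/subnK <-; elim: (m - n)%N => [|k [y yE]]; first by exists x.
  by exists (g _ y); rewrite hg.
have ph n : preserves_norm_forms (h n).
  move=> a s an v v0.
  have [st stE] := choice (fun i => hsurj (v i)).
  pose m := maxn n (\max_i st i).
  have [a' [s' [ea es an']]] : exists a' s' : S m,
      [/\ h m a' = h n a, h m s' = h n s & anisotropic (norm_form a' s')].
    move/subnK: (leq_maxl n (\max_i st i)); rewrite -/m => <-.
    elim: (m - n)%N => [|k [a' [s' [ea es an']]]]; first by exists a, s.
    exists (g _ a'), (g _ s'); rewrite !hg; split=> //.
    by have [pg _ _] := gP (k + n)%N; apply: pg.
  have [w wE] : exists w : 'I_4 -> S m, v = h m \o w.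
    have vm i : exists y : S m, h m y = v i.
      have [x ->] := stE i; apply: later.
      by rewrite (leq_trans (leq_bigmax i)) ?leq_maxr.
    by have [w wE] := choice vm; exists w; apply: funext => i; rewrite /= wE.
  move: v0; rewrite -ea -es -norm_form_morph wE qform_morph => /eqP.
  by rewrite fmorph_eq0 => /eqP/an' w0 i; rewrite /= w0 rmorph0.
exists L, (h 0%N); split; last 2 first.
- exact: (ph 0%N).
- exists S, (fun n => ext_map (S n)), g, h; split=> // [n|n x].
    by have [] := gP n.
  elim: n => [//|n IH]; have [_ _ gi] := gP n.
  by rewrite -IH -gi hg.
apply: (enumerable_image (g := fun nx : {n & S n} => h (tag nx) (tagged nx))).
  by apply: enumerable_sigT => n; apply: ext_enumerable.
by move=> y; have [n [x ->]] := hsurj y; exists (existT _ n x).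
Qed.

Lemma representing_closure_step (K : fieldType) :
  (2 : K) != 0 -> enumerable K ->
  exists (L : fieldType) (h : {rmorphism K -> L}),
    [/\ enumerable L, preserves_norm_forms h & forall t, represented_after h t].
Proof.
move=> two0 eK.
have [e eE] := enumerable_surj (enumerable_prod (enumerable_prod eK eK) eK) (0, 0, 0).
pose Q n (M N : fieldType) (i : {rmorphism K -> M}) (g : {rmorphism M -> N}) :=
  represented_after (g \o i) (e n).
have [|L [j [eL pj [M [i [g [h [Qg hg hi _]]]]]]]] := @tower_over K Q _ eK.
  move=> n M i eM; pose t := (i (e n).1.1, i (e n).1.2, i (e n).2).
  have two0M : (2 : M) != 0 by rewrite -(rmorph_nat i) fmorph_eq0.
  have [N [g [eN pg rg]]] := representing_step t two0M eM.
  exists N, g; split=> // b0 c0; apply: rg => /=; by rewrite fmorph_eq0.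
exists L, j; split=> // t; have [n <-] := eE t => b0 c0.
have hgi x : h n.+1 (g n (i n x)) = j x by rewrite hg hi.
have [[r rE]|[v vE]] := Qg n b0 c0.
  by left; exists (h n.+1 r); rewrite -rmorphXn rE /= hgi.
right; exists (h n.+1 \o v).
by rewrite -!hgi -pure_form_morph qform_morph vE.
Qed.

(** Each step of the second tower handles the triples of the preceding field, and
    every triple over the union comes from one of the steps. *)
Theorem representing_closure (K : fieldType) :
  (2 : K) != 0 -> enumerable K ->
  exists (L : fieldType) (j : {rmorphism K -> L}),
    preserves_norm_forms j /\
    forall a b c : L, b != 0 -> c != 0 -> (forall e, e ^+ 2 <> a) ->
      exists v, qform (pure_form b c) v = a.
Proof.
move=> two0 eK.
pose Q (n : nat) (M N : fieldType) (i : {rmorphism K -> M}) (g : {rmorphism M -> N}) :=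
  forall t, represented_after g t.
have [|L [j [eL pj [M [i [g [h [Qg hg hi hs]]]]]]]] := @tower_over K Q _ eK.
  move=> n M i eM; apply: representing_closure_step eM.
  by rewrite -(rmorph_nat i) fmorph_eq0.
have later n x m : (n <= m)%N -> exists y, h m y = h n x.
  move/subnK <-; elim: (m - n)%N => [|k [y yE]]; first by exists x.
  by exists (g _ y); rewrite hg.
exists L, j; split=> // a b c b0 c0 nsq.
have [na [xa aE]] := hs a; have [nb [xb bE]] := hs b; have [nc [xc cE]] := hs c.
pose n := (na + (nb + nc))%N.
have [a' a'E] : exists y, h n y = a by rewrite aE; apply: later; rewrite leq_addr.
have [b' b'E] : exists y, h n y = b by rewrite bE; apply: later; rewrite /n; lia.
have [c' c'E] : exists y, h n y = c by rewrite cE; apply: later; rewrite /n; lia.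
have b'0 : b' != 0 by rewrite -(fmorph_eq0 (h n)) b'E.
have c'0 : c' != 0 by rewrite -(fmorph_eq0 (h n)) c'E.
have [[r rE]|[v vE]] := Qg n (a', b', c') b'0 c'0.
  by case: (nsq (h n.+1 r)); rewrite -rmorphXn rE hg.
have hgn x : h n x = h n.+1 (g n x) by rewrite hg.
exists (h n.+1 \o v).
by rewrite -a'E -b'E -c'E !hgn -pure_form_morph qform_morph vE.
Qed.

(** * Division algebras over the rational function field *)

Lemma nonsquare_binary (F : fieldType) (a x y : F) :
  (forall e, e ^+ 2 <> a) -> x ^+ 2 - a * y ^+ 2 = 0 -> x = 0 /\ y = 0.
Proof.
move=> nsq e; have [y0|y0] := eqVneq y 0.
  by move/eqP: e; rewrite y0 expr0n mulr0 subr0 sqrf_eq0 => /eqP.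
case: (nsq (x / y)); apply: (mulIf (expf_neq0 2 y0)).
by rewrite -exprMn divfK //; apply/eqP; rewrite -subr_eq0 e.
Qed.

(** Infinite descent: evaluation at the simple root [r] shows that [x] and [y]
    vanish at [r], a division by [X - r] then shows the same for [z] and [t],
    and the four quotients form a smaller solution. *)
Lemma norm_form_simple_root (F : fieldType) (a r : F) (m : {poly F}) :
  (forall e, e ^+ 2 <> a) -> m.[r] != 0 ->
  anisotropic (norm_form a%:P (('X - r%:P) * m)).
Proof.
move=> nsq mr; apply/anisotropic_vec4 => x y z t e.
have L0 : 'X - r%:P != 0 by rewrite polyXsubC_eq0.
have [N] := ubnP (size x + size y + size z + size t)%N.
elim: N x y z t e => // N IH x y z t e sN.
have divL p : p.[r] = 0 -> exists q : {poly F},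
    p = q * ('X - r%:P) /\ (size q <= (size p).-1)%N.
  move/eqP/factor_theorem => [q ->]; exists q; split=> //.
  have [->|q0] := eqVneq q 0; first by rewrite size_poly0.
  by rewrite size_Mmonic ?monicXsubC // size_XsubC addn2.
have e1 : x.[r] ^+ 2 - a * y.[r] ^+ 2 = 0.
  rewrite -[RHS](horner0 r) -e !(hornerD, hornerN, hornerM, hornerC, hornerX, horner_exp); ring.
have [/divL[x' [xE sx]] /divL[y' [yE sy]]] := nonsquare_binary nsq e1.
have e2 : ('X - r%:P) * (x' ^+ 2 - a%:P * y' ^+ 2) = m * (z ^+ 2 - a%:P * t ^+ 2).
  apply: (mulfI L0); apply/eqP; rewrite -subr_eq0 -[X in _ == X]e xE yE.
  by apply/eqP; ring.
have e3 : z.[r] ^+ 2 - a * t.[r] ^+ 2 = 0.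
  apply: (mulfI mr); rewrite mulr0 -[RHS](mul0r (x' ^+ 2 - a%:P * y' ^+ 2).[r]).
  have -> : 0 = ('X - r%:P).[r] by rewrite hornerXsubC subrr.
  by rewrite -hornerM e2 !(hornerD, hornerN, hornerM, hornerC, hornerX, horner_exp).
have [/divL[z' [zE sz]] /divL[t' [tE st]]] := nonsquare_binary nsq e3.
have e4 : x' ^+ 2 - a%:P * y' ^+ 2 - ('X - r%:P) * m * z' ^+ 2
          + a%:P * (('X - r%:P) * m) * t' ^+ 2 = 0.
  apply: (mulfI L0); rewrite mulr0; apply/eqP.
  have -> : ('X - r%:P) * (x' ^+ 2 - a%:P * y' ^+ 2 - ('X - r%:P) * m * z' ^+ 2
          + a%:P * (('X - r%:P) * m) * t' ^+ 2) =
     ('X - r%:P) * (x' ^+ 2 - a%:P * y' ^+ 2) - m * (z ^+ 2 - a%:P * t ^+ 2).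
    by rewrite zE tE; ring.
  by rewrite e2 subrr.
have [s0|s0] := posnP (size x + size y + size z + size t)%N.
  by split; apply/eqP; rewrite -size_poly_eq0; lia.
have [|x0 y0 z0 t0] := IH x' y' z' t' e4; first last.
  by rewrite xE yE zE tE x0 y0 z0 t0 !mul0r.
move: sN s0 sx sy sz st; move: (size x) (size y) (size z) (size t).
by move: (size x') (size y') (size z') (size t') => *; lia.
Qed.

Lemma base_field_exists :
  exists (K : fieldType) (a : K) (s : nat -> K),
    [/\ (2 : K) != 0, enumerable K,
        forall n, anisotropic (norm_form a (s n)) &
        forall m n, m <> n -> anisotropic (norm_form a (s m * s n))].
Proof.
pose p n : {poly rat} := 'X - n%:R%:P.
have nsq (e : rat) : e ^+ 2 <> -1.
  by move=> e1; have := Num.Theory.sqr_ge0 e; rewrite e1.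
exists {fraction {poly rat}}, (ratC (-1)), (fun n => (p n)%:F); split.
- by rewrite -(rmorph_nat (@ratC rat)) fmorph_eq0.
- by apply: enumerable_ratfun; exists pickle; apply: pcan_inj pickleK.
- move=> n; rewrite -(norm_form_morph tofrac); apply: anisotropic_fraction.
  rewrite -[p n]mulr1; apply: norm_form_simple_root => //.
  by rewrite hornerC oner_eq0.
- move=> m n mn; rewrite -tofracM -(norm_form_morph tofrac).
  apply: anisotropic_fraction; apply: norm_form_simple_root => //.
  rewrite !hornerE subr_eq0; apply/negP => /eqP.
  by move/eqP; rewrite Num.Theory.eqr_nat => /eqP.
Qed.

(** * Quaternion algebras *)

(** Row vectors of coordinates in the basis [1], [i], [j], [ij]; unlike
    products of copies of [K], they carry no ring structure of their own. *)
Definition quaternion (K : fieldType) (a s : K) : Type := 'rV[K]_4.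

Section Quaternion.

Variables (K : fieldType) (a s : K).

Local Notation Q := (quaternion a s).

HB.instance Definition _ := Vector.copy Q 'rV[K]_4.

Implicit Types p q : Q.

Definition quat (x y z t : K) : Q := \row_i vec4 x y z t i.

Lemma quat_eta p : exists x y z t, p = quat x y z t.
Proof.
have [x [y [z [t e]]]] := vec4_eta (p 0); exists x, y, z, t.
by apply/rowP => i; rewrite mxE -e.
Qed.

Lemma quat_inj x y z t x' y' z' t' :
  quat x y z t = quat x' y' z' t' -> [/\ x = x', y = y', z = z' & t = t'].
Proof.
move/rowP => e; have ek i (lt : (i < 4)%N) := e (Ordinal lt).
by split; [move: (ek 0 isT) | move: (ek 1 isT) | move: (ek 2 isT) | move: (ek 3 isT)];
  rewrite !mxE.
Qed.

Lemma quatD x y z t x' y' z' t' :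
  quat x y z t + quat x' y' z' t' = quat (x + x') (y + y') (z + z') (t + t').
Proof. by apply/rowP => -[[|[|[|[|i]]]] lt] //; rewrite !mxE. Qed.

Lemma quatZ k x y z t : k *: quat x y z t = quat (k * x) (k * y) (k * z) (k * t).
Proof. by apply/rowP => -[[|[|[|[|i]]]] lt] //; rewrite !mxE. Qed.

Lemma quat0 : 0 = quat 0 0 0 0.
Proof. by apply/rowP => -[[|[|[|[|i]]]] lt] //; rewrite !mxE. Qed.

Definition quat_mul p q : Q :=
  let c (x : Q) n (lt : (n < 4)%N) := x 0 (Ordinal lt) in
  let: (p0, p1, p2, p3) := (c p 0 isT, c p 1 isT, c p 2 isT, c p 3 isT) in
  let: (q0, q1, q2, q3) := (c q 0 isT, c q 1 isT, c q 2 isT, c q 3 isT) in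
  quat (p0 * q0 + a * p1 * q1 + s * p2 * q2 - a * s * p3 * q3)
       (p0 * q1 + p1 * q0 + s * (p3 * q2 - p2 * q3))
       (p0 * q2 + p2 * q0 + a * (p1 * q3 - p3 * q1))
       (p0 * q3 + p3 * q0 + p1 * q2 - p2 * q1).

Lemma quat_mulE (p0 p1 p2 p3 q0 q1 q2 q3 : K) :
  quat_mul (quat p0 p1 p2 p3) (quat q0 q1 q2 q3) =
  quat (p0 * q0 + a * p1 * q1 + s * p2 * q2 - a * s * p3 * q3)
       (p0 * q1 + p1 * q0 + s * (p3 * q2 - p2 * q3))
       (p0 * q2 + p2 * q0 + a * (p1 * q3 - p3 * q1))
       (p0 * q3 + p3 * q0 + p1 * q2 - p2 * q1).
Proof. by rewrite /quat_mul !mxE. Qed.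

Lemma quat_mulA : associative quat_mul.
Proof.
move=> x y z; have [x0 [x1 [x2 [x3 ->]]]] := quat_eta x.
have [y0 [y1 [y2 [y3 ->]]]] := quat_eta y; have [z0 [z1 [z2 [z3 ->]]]] := quat_eta z.
by rewrite !quat_mulE; congr quat; ring.
Qed.

Lemma quat_mul1 : left_id (quat 1 0 0 0) quat_mul.
Proof.
move=> x; have [x0 [x1 [x2 [x3 ->]]]] := quat_eta x.
by rewrite !quat_mulE; congr quat; ring.
Qed.

Lemma quat_1mul : right_id (quat 1 0 0 0) quat_mul.
Proof.
move=> x; have [x0 [x1 [x2 [x3 ->]]]] := quat_eta x.
by rewrite !quat_mulE; congr quat; ring.
Qed.

Lemma quat_mulDl : left_distributive quat_mul +%R.
Proof.
move=> x y z; have [x0 [x1 [x2 [x3 ->]]]] := quat_eta x.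
have [y0 [y1 [y2 [y3 ->]]]] := quat_eta y; have [z0 [z1 [z2 [z3 ->]]]] := quat_eta z.
by rewrite quatD !quat_mulE quatD; congr quat; ring.
Qed.

Lemma quat_mulDr : right_distributive quat_mul +%R.
Proof.
move=> x y z; have [x0 [x1 [x2 [x3 ->]]]] := quat_eta x.
have [y0 [y1 [y2 [y3 ->]]]] := quat_eta y; have [z0 [z1 [z2 [z3 ->]]]] := quat_eta z.
by rewrite quatD !quat_mulE quatD; congr quat; ring.
Qed.

Lemma quat_one_neq0 : quat 1 0 0 0 != 0.
Proof. by apply/eqP; rewrite quat0 => /quat_inj[/eqP]; rewrite oner_eq0. Qed.

HB.instance Definition _ := GRing.Zmodule_isNzRing.Build Q
  quat_mulA quat_mul1 quat_1mul quat_mulDl quat_mulDr quat_one_neq0.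

Lemma quatM (p0 p1 p2 p3 q0 q1 q2 q3 : K) :
  quat p0 p1 p2 p3 * quat q0 q1 q2 q3 =
  quat (p0 * q0 + a * p1 * q1 + s * p2 * q2 - a * s * p3 * q3)
       (p0 * q1 + p1 * q0 + s * (p3 * q2 - p2 * q3))
       (p0 * q2 + p2 * q0 + a * (p1 * q3 - p3 * q1))
       (p0 * q3 + p3 * q0 + p1 * q2 - p2 * q1).
Proof. exact: quat_mulE. Qed.

Lemma quat_scaleAl (k : K) p q : k *: (p * q) = (k *: p) * q.
Proof.
have [x0 [x1 [x2 [x3 ->]]]] := quat_eta p; have [y0 [y1 [y2 [y3 ->]]]] := quat_eta q.
by rewrite quatM !quatZ quatM; congr quat; ring.
Qed.

HB.instance Definition _ := GRing.Lmodule_isLalgebra.Build K Q quat_scaleAl.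

Lemma quat_scaleAr (k : K) p q : k *: (p * q) = p * (k *: q).
Proof.
have [x0 [x1 [x2 [x3 ->]]]] := quat_eta p; have [y0 [y1 [y2 [y3 ->]]]] := quat_eta q.
by rewrite quatM !quatZ quatM; congr quat; ring.
Qed.

HB.instance Definition _ := GRing.Lalgebra_isAlgebra.Build K Q quat_scaleAr.
HB.instance Definition _ := Algebra_isFalgebra.Build K Q.

Lemma quat_alg k : k%:A = quat k 0 0 0.
Proof. by rewrite -[1]/(quat 1 0 0 0) quatZ mulr1 mulr0. Qed.

Lemma dim_quaternion : \dim {: Q} = 4%N.
Proof. by rewrite dimvf. Qed.

Hypotheses (two0 : (2 : K) != 0) (an : anisotropic (norm_form a s)).

Lemma anisotropic_neq0l : a != 0.
Proof.
apply/eqP => a0; have /anisotropic_vec4/(_ 0 1 0 0) := an.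
by case=> [|_ /eqP]; rewrite ?oner_eq0 // a0; ring.
Qed.

Lemma quaternion_division : is_division_algebra Q.
Proof.
move=> p; have [x [y [z [t ->]]]] := quat_eta p => p0.
pose N := x ^+ 2 - a * y ^+ 2 - s * z ^+ 2 + a * s * t ^+ 2.
have N0 : N != 0.
  apply: contraNneq p0; move/anisotropic_vec4: an => an' /an'[-> -> -> ->].
  by rewrite -quat0.
apply/unitrP; exists (quat (x / N) (- y / N) (- z / N) (- t / N)).
by split; rewrite quatM -[1]/(quat 1 0 0 0); congr quat; rewrite /N; field.
Qed.

Lemma quaternion_central : is_central Q.
Proof.
apply/eqP; rewrite eqEsubv; apply/andP; split; last first.
  by rewrite -memvE; apply/memv_capP; rewrite memvf; split=> //; apply: centv1.
apply/subvP => p /memv_capP[_ /centvP pC]; have [x [y [z [t pE]]]] := quat_eta p.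
have a0 := anisotropic_neq0l.
have diff0 (L R w : K) : L = R -> 2 * w = L - R -> w = 0.
  by move=> <- e; apply: (mulfI two0); rewrite e subrr mulr0.
have := pC (quat 0 1 0 0) (memvf _); rewrite pE !quatM => /quat_inj[_ _ e2 e3].
have t0 : t = 0 by apply: (mulfI a0); rewrite mulr0; apply: (diff0 _ _ _ (esym e2)); ring.
have z0 : z = 0 by apply: (diff0 _ _ _ (esym e3)); ring.
have := pC (quat 0 0 1 0) (memvf _); rewrite pE !quatM => /quat_inj[_ _ _ {}e3].
have y0 : y = 0 by apply: (diff0 _ _ _ e3); ring.
by apply/vlineP; exists x; rewrite quat_alg y0 z0 t0.
Qed.

Lemma quaternion_is_quaternion_division : is_quaternion_division Q.
Proof.
by split; [split; [apply: quaternion_division|apply: quaternion_central]|apply: dim_quaternion].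
Qed.

End Quaternion.

(** Let [i'], [j'] be the images in [(a, s)] of the generators of [(a, t)].
    As [i'] and [i] have the same square, some [u] conjugates [i'] to [i]: one
    takes [i i' + a = i (i' + i)], or [j] if [i' = -i].  The conjugate of [j']
    anticommutes with [i], hence equals [x2 j + x3 ij], and computing its square
    gives [t s = (s x2)^2 - a (s x3)^2]. *)
Lemma quaternion_iso_norm (K : fieldType) (a s t : K) :
  (2 : K) != 0 -> anisotropic (norm_form a s) ->
  alg_isomorphic (quaternion a t) (quaternion a s) ->
  ~ anisotropic (norm_form a (t * s)).
Proof.
move=> two0 an [f _] /anisotropic_vec4 ants.
have div := quaternion_division an; have a0 := anisotropic_neq0l an.
pose i := quat a s 0 1 0 0; pose j := quat a s 0 0 1 0.
pose i' := f (quat a t 0 1 0 0); pose j' := f (quat a t 0 0 1 0).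
have ii : i * i = a%:A by rewrite quat_alg quatM; congr quat; ring.
have i'i' : i' * i' = a%:A.
  rewrite -rmorphM -[RHS](rmorph_alg f) quat_alg quatM; congr (f _); congr quat; ring.
have j'j' : j' * j' = t%:A.
  rewrite -rmorphM -[RHS](rmorph_alg f) quat_alg quatM; congr (f _); congr quat; ring.
have i'j' : i' * j' = - (j' * i').
  rewrite -!rmorphM -rmorphN; congr (f _); rewrite -scaleN1r !quatM quatZ; congr quat; ring.
have [u [u0 iu]] : exists u, u != 0 /\ i * u = u * i'.
  have [e|ne] := eqVneq i' (- i).
    exists j; rewrite e; split; last first.
      rewrite mulrN -scaleN1r !quatM quatZ; congr quat; ring.
    by apply/eqP; rewrite quat0 => /quat_inj[_ _ /eqP]; rewrite oner_eq0.
  exists (i * i' + a%:A); split.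
    rewrite -ii -mulrDr; apply: contra ne => /eqP e.
    have i0 : i \is a GRing.unit.
      apply: div; apply/eqP; rewrite quat0 => /quat_inj[_ /eqP]; by rewrite oner_eq0.
    rewrite -addr_eq0; apply/eqP/(mulrI i0); rewrite e mulr0 //.
  rewrite mulrDr mulrDl mulrA ii -mulrA i'i' -!scalerAl -!scalerAr mul1r mulr1 addrC.
  by [].
have uU := div _ u0.
pose j2 := u * j' / u.
have j2j2 : j2 * j2 = t%:A.
  by rewrite /j2 !mulrA mulrVK // -[u * j' * j']mulrA j'j' -scalerAr mulr1 -scalerAl mulrV.
have ij2 : i * j2 = - (j2 * i).
  have vi : u^-1 * i = i' * u^-1.
    by apply: (mulrI uU); rewrite mulrA mulrV // mul1r mulrA -iu mulrK.
  by rewrite /j2 -!mulrA vi !mulrA iu -!mulrA [i' * _]mulrA i'j' !mulNr !mulrN !mulrA.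
have [x0 [x1 [x2 [x3 j2E]]]] := quat_eta j2.
move: ij2; rewrite j2E -scaleN1r !quatM quatZ => /quat_inj[e1 e0 _ _].
have diff0 (L R w : K) : L = R -> 2 * w = L - R -> w = 0.
  by move=> <- e; apply: (mulfI two0); rewrite e subrr mulr0.
have x00 : x0 = 0 by apply: (diff0 _ _ _ e0); ring.
have x10 : x1 = 0 by apply: (mulfI a0); rewrite mulr0; apply: (diff0 _ _ _ e1); ring.
move: j2j2; rewrite j2E quat_alg quatM => /quat_inj[tE _ _ _].
have [|_ _ /eqP] := ants (s * x2) (s * x3) 1 0; last by rewrite oner_eq0.
by rewrite -tE x00 x10; ring.
Qed.

(** * Maximal subfields of quaternion division algebras *)

Lemma alg_isomorphic_trans (K : fieldType) (A B C : falgType K) :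
  alg_isomorphic A B -> alg_isomorphic B C -> alg_isomorphic A C.
Proof.
move=> [f bf] [g bg]; exists (g \o f)%AF.
apply: (eq_bij (bij_comp bg bf)) => x; by rewrite /= lfunE.
Qed.

(** Both algebras are [K[X] / (X^2 - a)]. *)
Lemma quadratic_alg_isomorphic (K : fieldType) (A B : falgType K) (x : A) (y : B) (a : K) :
  \dim {: A} = 2 -> \dim {: B} = 2 -> x \notin 1%VS -> y \notin 1%VS ->
  x * x = a%:A -> y * y = a%:A -> alg_isomorphic A B.
Proof.
(* coordinates of a quadratic algebra in the basis [1], [z] *)
have coords (C : falgType K) (z : C) : \dim {: C} = 2 -> z \notin 1%VS ->
    exists c0 c1 : {linear C -> K^o},
      [/\ forall w, w = (c0 w)%:A + c1 w *: z & forall u v,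
          c0 (u%:A + v *: z) = u /\ c1 (u%:A + v *: z) = v].
  move=> dC z1; pose X := [tuple z; 1].
  have fX : free X by rewrite free_cons span_seq1 z1 seq1_free oner_eq0.
  have sX : <<X>>%VS = fullv.
    by apply/eqP; rewrite eqEdim subvf dC; move: fX => /eqP ->.
  exists (coord X 1), (coord X 0); split=> [w|u v].
    rewrite {1}(coord_span (X := X) (v := w)) ?sX ?memvf // !big_ord_recl big_ord0 addr0.
    rewrite addrC; congr (coord X _ w *: _ + _); exact: val_inj.
  pose k (i : 'I_2) : K := if i == 0 then v else u.
  have -> : u%:A + v *: z = \sum_(i < 2) k i *: X`_i.
    by rewrite !big_ord_recl big_ord0 addr0 /= addrC.
  by split; [apply: (coord_sum_free k 1 fX) | apply: (coord_sum_free k 0 fX)].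
move=> dA dB x1 y1 xx yy.
have [p0 [p1 [pE pK]]] := coords A x dA x1; have [q0 [q1 [qE qK]]] := coords B y dB y1.
pose g (w : A) : B := (p0 w)%:A + p1 w *: y.
have gl : linear g.
  move=> k v w; rewrite /g (linearP p0) (linearP p1) /=.
  rewrite -[k *: p0 v]/(k * p0 v) -[k *: p1 v]/(k * p1 v).
  by rewrite scalerDr !scalerDl !scalerA addrACA.
have gm : monoid_morphism g.
  split=> [|v w].
    have -> : 1 = 1%:A + 0 *: x :> A by rewrite scale1r scale0r addr0.
    by rewrite /g; case: (pK 1 0) => -> ->; rewrite scale1r scale0r addr0.
  have mulE (C : falgType K) (z : C) (m n m' n' : K) : z * z = a%:A ->
      (m%:A + n *: z) * (m'%:A + n' *: z) =
      (m * m' + n * n' * a)%:A + (m * n' + n * m') *: z.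
    move=> zz; rewrite mulrDl !mulrDr -!scalerAl -!scalerAr !mul1r zz mulr1 !scalerA.
    by rewrite !scalerDl [(n * m') *: z + _]addrC addrACA.
  rewrite /g mulE // {1 2}(pE v) {1 2}(pE w) mulE //.
  by case: (pK (p0 v * p0 w + p1 v * p1 w * a) (p0 v * p1 w + p1 v * p0 w)) => -> ->.
pose gL : {lrmorphism A -> B} := HB.pack g (GRing.isLinear.Build _ _ _ _ g gl)
  (GRing.isMonoidMorphism.Build _ _ g gm).
have gE w : AHom (linfun_is_ahom gL) w = g w by rewrite -[LHS]/(linfun gL w) lfunE.
exists (AHom (linfun_is_ahom gL)).
exists (fun w => (q0 w)%:A + q1 w *: x) => w; rewrite gE /g.
  by have [-> ->] := qK (p0 w) (p1 w); rewrite -pE.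
by have [-> ->] := pK (q0 w) (q1 w); rewrite -qE.
Qed.

Section QuaternionDivision.

Variables (K : fieldType) (D : falgType K).
Hypothesis quatdivD : is_quaternion_division D.

Let divD : is_division_algebra D. Proof. by case: quatdivD => -[]. Qed.
Let dimD : \dim {: D} = 4%N. Proof. by case: quatdivD. Qed.

Lemma central_scalar (x : D) : (forall y, x * y = y * x) -> x \in 1%VS.
Proof.
have [[_ <-] _] := quatdivD => xC; apply/memv_capP; split; first exact: memvf.
by apply/centvP => y _.
Qed.

Lemma nonscalar_exists : exists x : D, x \notin 1%VS.
Proof.
apply/not_existsP => no; suff: (\dim {: D} <= \dim (1%VS : {vspace D}))%N by rewrite dimD dimv1.
by apply/dimvS/subvP => x _; apply/negPn/negP/no.
Qed.

(** [D] is a left vector space over the skew field ['C[x]], so the dimension of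
    ['C[x]] divides 4; it is neither 1, as [x] is not scalar, nor 4, as [x] is
    not central. *)
Lemma nonscalar_span (x : D) : x \notin 1%VS ->
  'C[x]%VS = (1 + <[x]>)%VS /\ \dim 'C[x] = 2.
Proof.
move=> x1; have sub : (1 + <[x]> <= 'C[x])%VS.
  by rewrite subv_add -!memvE cent1v1 cent1v_id.
have d2 : (1 < \dim (1 + <[x]>))%N.
  rewrite ltnNge; apply: contra x1 => le; suff -> : (1 = 1 + <[x]> :> {vspace D})%VS.
    by rewrite memvE addvSr.
  by apply/eqP; rewrite eqEdim addvSl dimv1.
have d4 : (\dim 'C[x] %| 4)%N by rewrite -dimD (skew_field_dimS divD) ?subvf.
have n4 : \dim 'C[x] <> 4.
  move=> e; case/negP: x1; apply: central_scalar => y; apply/cent1vP; rewrite cent1vC.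
  have -> : 'C[x]%VS = fullv by apply/eqP; rewrite eqEdim subvf dimD e.
  exact: memvf.
have dC : \dim 'C[x] = 2.
  have := dimvS sub; have := dvdn_leq (isT : (0 < 4)%N) d4; move: d4 d2 n4.
  by move: (\dim (_ + _)); case: (\dim 'C[x]) => [|[|[|[|[|k]]]]] //=; lia.
split=> //; apply/esym/eqP; rewrite eqEdim sub dC //.
Qed.

Lemma cent1_maximal_subfield (x : D) : x \notin 1%VS -> is_maximal_subfield 'C[x]%AS.
Proof.
move=> x1; have [CE _] := nonscalar_span x1; split.
  split=> [|y z|y yC y0]; first exact: cent1v1.
    rewrite /= CE => /memv_addP[_ /vlineP[u ->] [_ /vlineP[v ->] ->]].
    move=> /memv_addP[_ /vlineP[u' ->] [_ /vlineP[v' ->] ->]].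
    rewrite !mulrDl !mulrDr -!scalerAl -!scalerAr !mul1r !mulr1 !scalerA.
    by rewrite [u' * u]mulrC [u' * v]mulrC [v' * u]mulrC [v' * v]mulrC addrACA.
  by split; [apply: divD | rewrite memvV].
move=> F [_ Fc _] CF; apply/eqP; rewrite eqEsubv CF andbT.
apply/subvP => y Fy; apply/cent1vP; apply: Fc => //.
by apply: (subvP CF); apply: cent1v_id.
Qed.

Lemma maximal_subfield_cent1 (E : {aspace D}) : is_maximal_subfield E ->
  exists x, x \notin 1%VS /\ (E : {vspace D}) = 'C[x]%VS.
Proof.
move=> [[E1 Ec _] Emax].
have [E0|/subvPn[x Ex x1]] := boolP (E <= 1)%VS.
  have [y y1] := nonscalar_exists; exists y; split=> //; apply/esym.
  apply: (Emax 'C[y]%AS); first by case: (cent1_maximal_subfield y1).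
  by apply: (subv_trans E0); rewrite -memvE cent1v1.
exists x; split=> //; apply/esym.
apply: (Emax 'C[x]%AS); first by case: (cent1_maximal_subfield x1).
by apply/subvP => y Ey; apply/cent1vP; apply: Ec.
Qed.

Lemma pure_square_nonsquare (x : D) (a e : K) : x \notin 1%VS -> x * x = a%:A -> e ^+ 2 <> a.
Proof.
move=> x1 xx ea; have p0 : (x - e%:A) * (x + e%:A) = 0.
  rewrite mulrBl !mulrDr xx -ea -!scalerAl -!scalerAr !mul1r !mulr1 scalerA expr2.
  by rewrite opprD addrA addrK subrr.
have [xe|/divD xe] := eqVneq (x - e%:A) 0.
  by case/negP: x1; move/eqP: xe; rewrite subr_eq0 => /eqP ->; rewrite memvZ ?memv_line.
move: p0; rewrite -[RHS](mulr0 (x - e%:A)) => /(mulrI xe)/eqP.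
rewrite addr_eq0 => /eqP e0; case/negP: x1.
by rewrite e0 memvN memvZ ?memv_line.
Qed.

Hypothesis two0 : (2 : K) != 0.

(** [x] is a root of a quadratic polynomial by [nonscalar_span]; complete the
    square. *)
Lemma nonscalar_pure (x : D) : x \notin 1%VS ->
  exists (y : D) (a : K),
    [/\ y \notin 1%VS, y * y = a%:A & 'C[y]%VS = 'C[x]%VS].
Proof.
move=> x1; have [CE _] := nonscalar_span x1.
have : x * x \in (1 + <[x]>)%VS by rewrite -CE -expr2 cent1vX.
move=> /memv_addP[_ /vlineP[u ->] [_ /vlineP[v ->] xx]].
pose y := x - (v / 2)%:A; exists y, (u + (v / 2) ^+ 2).
have y1 : y \notin 1%VS.
  apply: contra x1 => y1; rewrite -[x](subrK (v / 2)%:A) memvD // memvZ // memv_line //.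
split=> //.
  rewrite /y mulrBl !mulrBr xx -!scalerAl -!scalerAr !mul1r !mulr1 scalerA.
  have -> : v *: x = (v / 2) *: x + (v / 2) *: x by rewrite -scalerDl; congr (_ *: x); field.
  by rewrite addrA addrK opprB addrACA subrr addr0 scalerDl expr2.
have [Cy dy] := nonscalar_span y1; apply/eqP; rewrite eqEdim dy.
have [_ ->] := nonscalar_span x1; rewrite leqnn andbT Cy subv_add -!memvE cent1v1 /=.
by rewrite memvB ?cent1v_id // memvZ // cent1v1.
Qed.

(** A pure [i] and any [y] that does not commute with it give
    [j = iy - yi], which anticommutes with [i]; its square lies in [K + Kj] and
    commutes with [i], so it is a scalar. *)
Lemma quaternion_generators :
  exists (i j : D) (b c : K),
    [/\ b != 0, c != 0, i * i = b%:A, j * j = c%:A & i * j = - (j * i)].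
Proof.
have [x x1] := nonscalar_exists; have [i [b [i1 ii Ci]]] := nonscalar_pure x1.
have [y iy] : exists y, i * y != y * i.
  apply/not_existsP => no; case/negP: i1; apply: central_scalar => y.
  by apply/eqP/negPn/negP/no.
pose j := i * y - y * i; have j0 : j != 0 by rewrite subr_eq0.
have ij : i * j = - (j * i).
  rewrite mulrBr mulrBl mulrA ii -!mulrA ii opprB -!scalerAr -!scalerAl mul1r mulr1 mulrA.
  by [].
have b0 : b != 0.
  apply/eqP => b0; apply: (pure_square_nonsquare (e := 0) i1 ii).
  by rewrite b0 expr0n.
have i0 : i != 0 by apply: contraNneq i1 => ->; apply: mem0v.
have double0 (w : D) : w = - w -> w = 0.
  move/eqP; rewrite -addr_eq0 -mulr2n -scaler_nat scaler_eq0 (negPf two0) /=.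
  by move/eqP.
have ij0 : i * j != 0.
  by apply: contra j0 => /eqP e; apply/eqP/(mulrI (divD i0)); rewrite e mulr0.
have j1 : j \notin 1%VS.
  apply: contra ij0 => /vlineP[k jk]; apply/eqP/double0.
  by rewrite {1}ij jk -scalerAl -scalerAr mul1r mulr1.
have [Cj _] := nonscalar_span j1.
have /memv_addP[_ /vlineP[c ->] [_ /vlineP[v ->] jj]] : j * j \in (1 + <[j]>)%VS.
  by rewrite -Cj -expr2 cent1vX.
have v0 : v = 0.
  apply/eqP/negPn/negP => v0; case/negP: ij0; apply/eqP/double0; rewrite {1}ij.
  congr (- _); apply: (scalerI v0).
  (* j * j commutes with i *)
  have : i * (j * j) = j * j * i by rewrite mulrA ij mulNr -!mulrA ij mulrN opprK.
  rewrite jj mulrDr mulrDl -!scalerAl -!scalerAr mulr1 mul1r.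
  by move/addrI => ->.
have jc : j * j = c%:A by rewrite jj v0 scale0r addr0.
have c0 : c != 0.
  apply/eqP => c0; apply: (pure_square_nonsquare (e := 0) j1 jc).
  by rewrite c0 expr0n.
by exists i, j, b, c.
Qed.

Lemma pure_value (i j : D) (b c : K) (v : 'I_3 -> K) :
  i * i = b%:A -> j * j = c%:A -> i * j = - (j * i) ->
  exists x : D, x * x = (qform (pure_form b c) v)%:A.
Proof.
move=> ii jj ij; have [x [y [z ->]]] := vec3_eta v.
exists (x *: i + y *: j + z *: (i * j)); rewrite pure_formE.
have sqD (A B : D) : A * B = - (B * A) -> (A + B) * (A + B) = A * A + B * B.
  by move=> AB; rewrite mulrDl !mulrDr AB addrA subrK.
have ji : j * i = - (i * j) by rewrite ij opprK.
have jij : j * (i * j) = - c *: i.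
  by rewrite mulrA ji mulNr -mulrA jj -scalerAr mulr1 scaleNr.
have iji : i * j * i = - b *: j.
  by rewrite -mulrA ji mulrN mulrA ii -scalerAl mul1r scaleNr.
rewrite sqD; last first.
  rewrite mulrDl mulrDr -!scalerAl -!scalerAr iji jij !mulrA ii -[i * j * j]mulrA jj.
  rewrite -scalerAl -scalerAr mul1r mulr1 !scaleNr !scalerN opprD !opprK !scalerA.
  by rewrite [z * x]mulrC mulrA [z * y]mulrC.
rewrite sqD; last by rewrite -!scalerAl -!scalerAr !scalerA ij scalerN mulrC.
rewrite -!scalerAl -!scalerAr mulrA iji -scalerAl jj ii !scalerA -!scalerDl.
by congr (_ *: _); ring.
Qed.

End QuaternionDivision.

(** A maximal subfield of [D] is generated by some [y] whose square is a
    non-square [a].  By hypothesis [D'] contains [z] with the same square, and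
    the centralizers of [y] and [z] are isomorphic. *)
Lemma Max_transfer (K : fieldType) (D D' : falgType K) (L : fieldExtType K) :
  (2 : K) != 0 ->
  (forall a b c : K, b != 0 -> c != 0 -> (forall e, e ^+ 2 <> a) ->
      exists v, qform (pure_form b c) v = a) ->
  is_quaternion_division D -> is_quaternion_division D' -> Max D L -> Max D' L.
Proof.
move=> two0 rep QD QD' [E [Emax LE]].
have [x [x1 EC]] := maximal_subfield_cent1 QD Emax.
have [y [a [y1 yy Cy]]] := nonscalar_pure QD two0 x1.
have nsq e : e ^+ 2 <> a := pure_square_nonsquare QD y1 yy.
have [i [j [b [c [b0 c0 ii jj ij]]]]] := quaternion_generators QD' two0.
have [v vE] := rep a b c b0 c0 nsq.
have [z] := pure_value v ii jj ij; rewrite vE => zz.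
have z1 : z \notin 1%VS.
  apply/negP => /vlineP[k zk]; apply: (nsq k).
  move: zz; rewrite zk -scalerAl mul1r scalerA => /eqP.
  by rewrite -subr_eq0 -scalerBl scaler_eq0 oner_eq0 orbF subr_eq0 => /eqP.
exists 'C[z]%AS; split; first exact: cent1_maximal_subfield.
apply: alg_isomorphic_trans LE _.
have dims (A : falgType K) (F : {aspace A}) w : is_quaternion_division A ->
    w \notin 1%VS -> (F : {vspace A}) = 'C[w]%VS -> \dim {: subvs_of F} = 2.
  by move=> QA w1 Fw; rewrite dimvf -[LHS]/(\dim F) Fw; case: (nonscalar_span QA w1).
have sub (A : falgType K) (F : {aspace A}) w (Fw : w \in F) : 1 \in F ->
    w \notin 1%VS -> w * w = a%:A ->
    Subvs Fw \notin 1%VS /\ Subvs Fw * Subvs Fw = a%:A :> subvs_of F.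
  move=> F1 w1 ww; have F1' : algid F = 1 by apply/eqP; rewrite algid_eq1.
  split; last by apply: val_inj; rewrite /= ww F1'.
  apply: contra w1 => /vlineP[k /(congr1 val)] /= ->; rewrite F1'.
  by rewrite memvZ ?memv_line.
have yE : y \in E by rewrite EC -Cy cent1v_id.
have zC : z \in ('C[z]%AS : {vspace D'}) := cent1v_id z.
have [E1 _ _] := Emax.1.
have [y1' yy'] := sub _ _ _ yE E1 y1 yy.
have [z1' zz'] := sub _ _ _ zC (cent1v1 z) z1 zz.
apply: quadratic_alg_isomorphic y1' z1' yy' zz'; [exact: dims EC | exact: dims z1 _].
Qed.

(** * Weakly isomorphic quaternion algebras *)

Theorem theoremC :
  exists K : fieldType,
    (exists Q : nat -> falgType K,
        (forall n : nat, is_quaternion_division (Q n)) /\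
        (forall m n : nat, m <> n -> ~ alg_isomorphic (Q m) (Q n))) /\
    (forall D D' : falgType K,
        is_quaternion_division D -> is_quaternion_division D' ->
        weakly_isomorphic D D').
Proof.
have [K0 [a [s [two0 eK san ssan]]]] := base_field_exists.
have [K [j [jan rep]]] := representing_closure two0 eK.
have two0K : (2 : K) != 0 by rewrite -(rmorph_nat j) fmorph_eq0.
exists K; split.
  exists (fun n => quaternion (j a) (j (s n)) : falgType K); split.
    by move=> n; apply: quaternion_is_quaternion_division (jan _ _ (san n)).
  move=> m n mn iso; apply: (quaternion_iso_norm two0K (jan _ _ (san n)) iso).
  by rewrite -rmorphM; apply: jan; apply: ssan.
by move=> D D' QD QD' L; split; apply: Max_transfer.
Qed.
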